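(* Let $w_n$ be the number of weak-ordering chains in $\mathcal{WOC}(n)$ subject to the stopping condition $x_{i_1}\le x_{i_2}<x_{i_3}$ with $i_1<i_2<i_3$. Then \[ w_n=\sum_{d=0}^{n-1}2^dN_{n,d}+\sum_{j=3}^{n}\sum_{d=1}^{j-2}2^d\ell_{j,d}. \] The sequence starts $1,3,13,65,341,1827,9913,54273,299209,1658723,\dots$, and $W(x)=\sum_{n\ge1}w_nx^n$ satisfies \[ W(x)=\frac{(1-x)^2-(1-3x)\sqrt{1-6x+x^2}}{4(1-x)\sqrt{1-6x+x^2}}. \]
   Context: A weak-ordering chain on $x_1,\dots,x_m$ is an expression $x_{i_1}\,\mathrm{op}\,x_{i_2}\,\mathrm{op}\cdots\mathrm{op}\,x_{i_m}$, where $(i_1,\dots,i_m)$ is an ordering of $[m]$ and each $\mathrm{op}$ is $<$ or $=$; expressions defining the same ordered set partition of $[m]$ are identified. $\mathcal{WOC}(m)$ is the set of these chains. Each chain in $\mathcal{WOC}(m)$, $m\ge 2$, arises uniquely from its restriction to $x_1,\dots,x_{m-1}$ by inserting $x_m$; this gives a rooted tree with root $x_1$ whose level-$m$ nodes are the elements of $\mathcal{WOC}(m)$. The restricted generating tree of order $n$ for a stopping condition is the part of this tree up to level $n$ in which any node containing the stopping condition has no descendants; ''the number of weak-ordering chains in $\mathcal{WOC}(n)$ subject to the stopping condition'' is the number of leaves of this tree (nodes at level $n$ plus nodes containing the condition), equivalently the number of chains in $\mathcal{WOC}(n)$ avoiding the condition plus, for each $j\le n$, the number of chains in $\mathcal{WOC}(j)$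 containing the condition whose restriction to $x_1,\dots,x_{j-1}$ avoids it. Here a chain contains the stopping condition if there are indices $i_1<i_2<i_3$ such that $x_{i_1}<x_{i_2}$ or $x_{i_1}=x_{i_2}$, and $x_{i_2}<x_{i_3}$, in the chain. $N_{n,d}=\frac1n\binom{n}{d}\binom{n}{d+1}$ are the Narayana numbers. $\ell_{j,d}=|\mathcal{G}^d_j(213)|$, where for $j>3$, $1\le d\le j-2$, $\mathcal{G}^d_j(213)$ is the set of permutations $\sigma$ of $[j]$ that contain the pattern $213$ (indices $a<b<c$ with $\sigma(b)<\sigma(a)<\sigma(c)$), have exactly $d$ descents, and such that the permutation obtained by deleting $j$ avoids $213$; and $\mathcal{G}^1_3(213)=\{213\}$, so $\ell_{3,1}=1$. *)

(* Defs.v *)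
(* boolp serves only to give the type of formal power series extensional equality
   and a choiceType structure. *)
From HB Require Import structures.
From mathcomp Require Import all_boot all_order all_fingroup all_algebra.
From mathcomp Require Import boolp ring.

Set Implicit Arguments.
Unset Strict Implicit.
Unset Printing Implicit Defensive.

Import GRing.Theory.

(* The variables x_1, ..., x_m are indexed by 'I_m, shifted by one; the k-th
   variable written in an expression is the image of k under the permutation.
   Between positions k and k + 1 stands the k-th entry of the tuple, where true
   stands for "<" and false for "=". *)
Definition woc_expr (m : nat) : Type := ('S_m * (m.-1).-tuple bool)%type.

(* The ordered set partition defined by an expression: the block that a position
   belongs to is the number of signs "<" to its left. *)
Definition expr_blocks (m : nat) (e : woc_expr m) : seq {set 'I_m} :=
  [seq [set e.1 k | k : 'I_m & count id (take k e.2) == b]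
     | b <- iota 0 (count id e.2).+1].

(* For m > 0 these are all the ordered set partitions, see WOC_partition. *)
Definition WOC (m : nat) : {set {bseq m of {set 'I_m}}} :=
  [set P : {bseq m of {set 'I_m}} |
     [exists e : woc_expr m, (P : seq _) == expr_blocks e]].

Definition woc_rank (m : nat) (P : seq {set 'I_m}) (i : 'I_m) : nat :=
  find (fun B : {set 'I_m} => i \in B) P.

Lemma WOC_partition (m : nat) (P : {bseq m of {set 'I_m}}) : 0 < m ->
  (P \in WOC m) = uniq P && partition [set B in P] [set: 'I_m].
Proof.
move=> m_gt0.
have -> : [set B in P] = [set B in (P : seq _)] by apply/setP => A; rewrite !inE.
rewrite inE; apply/existsP/idP => [[[p op] /eqP defP]|].
  rewrite {}defP /expr_blocks.
  pose c k := count id (take k op); pose C := count id op.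
  pose B b := [set p k | k : 'I_m & c k == b].
  have memB b i : (i \in B b) = (c (p^-1%g i) == b).
    apply/imsetP/idP => [[k]|h]; first by rewrite inE => h ->; rewrite permK.
    by exists (p^-1%g i); rewrite ?inE ?permKV.
  have cE : c m.-1 = C by rewrite /c take_oversize // size_tuple.
  have le_cC k : c k <= C by rewrite /C -[X in _ <= count _ X](cat_take_drop k) count_cat leq_addr.
  have cS k : c k.+1 <= (c k).+1.
    rewrite /c; have [lt_k|le_k] := ltnP k (size op).
      by rewrite (take_nth true) // -cats1 count_cat /= addn0 -addn1 leq_add2l leq_b1.
    by rewrite !take_oversize // (leq_trans le_k).
  have Bn0 b : b <= C -> exists i, i \in B b.
    move=> le_bC; have ex : exists k, b <= c k by exists m.-1; rewrite cE.
    case: (ex_minnP ex) => k le_b min_k.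
    have lt_km : k < m by rewrite -(prednK m_gt0) ltnS min_k ?cE.
    exists (p (Ordinal lt_km)); rewrite memB permK /= eqn_leq le_b andbT.
    case: k le_b min_k {lt_km} => [|k] le_b min_k; first by rewrite /c take0.
    apply: leq_trans (cS k) _; rewrite ltnNge; apply/negP => /min_k.
    by rewrite ltnn.
  rewrite -/C -[[seq _ | b <- _]]/[seq B b | b <- iota 0 C.+1].
  have memP b : (b \in iota 0 C.+1) = (b <= C) by rewrite mem_iota.
  move: (iota 0 C.+1) (iota_uniq 0 C.+1) memP => t t_uniq memP.
  apply/andP; split.
    rewrite map_inj_in_uniq // => b b'; rewrite !memP => /Bn0[i Bi] _ eB.
    have := Bi; rewrite eB memB => /eqP <-; by move: Bi; rewrite memB => /eqP.
  apply/and3P; split.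
  - apply/eqP/setP => i; rewrite inE; apply/bigcupP; exists (B (c (p^-1%g i))).
      by rewrite inE; apply/mapP; exists (c (p^-1%g i)); rewrite ?memP.
    by rewrite memB.
  - apply/trivIsetP => A A'; rewrite !inE => hA hA'.
    case/mapP: hA => b _ ->; case/mapP: hA' => b' _ -> neB.
    rewrite -setI_eq0; apply: contraNT neB => /set0Pn[i].
    by rewrite inE !memB => /andP[/eqP-> /eqP->].
  - rewrite inE; apply/negP => hB; case/mapP: hB => b; rewrite memP => /Bn0[i].
    by move=> Bi B0; move: Bi; rewrite -B0 inE.
case/andP => uP /and3P[/eqP covP /trivIsetP trP P0].
pose r := woc_rank P.
have rlt i : r i < size P.
  rewrite /r /woc_rank -has_find; have := in_setT i; rewrite -covP.
  by case/bigcupP => A; rewrite inE => PA Ai; apply/hasP; exists A.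
have rin i : i \in nth set0 P (r i).
  by apply: (nth_find set0 (a := fun B : {set 'I_m} => i \in B)); rewrite has_find; apply: rlt.
have rE b i : b < size P -> (i \in nth set0 P b) = (r i == b).
  move=> lt_b; apply/idP/eqP => [bi|<-]; last exact: rin.
  apply/eqP; rewrite -(nth_uniq set0 (rlt i) lt_b uP).
  apply: contraTT bi => /trP; rewrite !inE !mem_nth // => /(_ isT isT) dis.
  by rewrite (disjointFr dis (rin i)).
have rsurj b : b < size P -> exists i, r i = b.
  move=> lt_b; have : nth set0 P b != set0.
    by apply: contraNneq P0 => <-; rewrite inE mem_nth.
  by case/set0Pn => i; rewrite rE // => /eqP; exists i.
pose s := sort (relpre r leq) (enum 'I_m).
have sz_s : size s = m by rewrite size_sort size_enum_ord.
have u_s : uniq s by rewrite sort_uniq enum_uniq.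
have mem_s i : i \in s by rewrite mem_sort mem_enum.
pose i0 := Ordinal m_gt0.
pose rs k := r (nth i0 s k).
have rs_mono : {in [pred k | k < m] &, {homo rs : k l / k <= l}}.
  have tot : total (relpre r leq) by move=> x y; apply: leq_total.
  have srt : sorted (relpre r leq) s by exact: (sort_sorted tot).
  move=> k l lt_k lt_l le_kl.
  have tr : transitive (relpre r leq) by move=> y x z; apply: leq_trans.
  have rf : reflexive (relpre r leq) by move=> x; apply: leqnn.
  apply: (sorted_leq_nth tr rf i0 srt k l _ _ le_kl); by rewrite inE sz_s.
have rs_surj b : b < size P -> exists2 k, k < m & rs k = b.
  move=> /rsurj[i <-]; exists (index i s); first by rewrite -{2}sz_s index_mem.
  by rewrite /rs nth_index.
have rsS k : k.+1 < m -> rs k.+1 = rs k + (rs k < rs k.+1).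
  move=> lt_k; have lt_k' := ltnW lt_k.
  have := rs_mono k k.+1 lt_k' lt_k (leqnSn k); rewrite leq_eqVlt.
  case/predU1P => [->|lt_rs]; first by rewrite ltnn addn0.
  rewrite lt_rs addn1; apply/eqP; rewrite eqn_leq lt_rs andbT leqNgt; apply/negP => gap.
  have [l lt_l rl] := rs_surj (rs k).+1 (ltn_trans gap (rlt _)).
  have [le_lk|lt_kl] := leqP l k.
    by have := rs_mono l k lt_l lt_k' le_lk; rewrite rl ltnn.
  by have := rs_mono k.+1 l lt_k lt_l lt_kl; rewrite rl leqNgt gap.
have P_gt0 : 0 < size P by apply: leq_ltn_trans (rlt i0).
have rs0 : rs 0 = 0.
  have [k lt_k rk] := rs_surj 0 P_gt0.
  by apply/eqP; rewrite -leqn0 -[X in _ <= X]rk; apply: rs_mono.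
have rs_last : rs m.-1 = (size P).-1.
  have lt_m : m.-1 < m by rewrite ltn_predL.
  have [k lt_k rk] := rs_surj (size P).-1 ltac:(by rewrite ltn_predL).
  apply/eqP; rewrite eqn_leq -ltnS prednK // rlt /= -rk.
  by apply: rs_mono; rewrite // -ltnS prednK.
have inj_s : injective (fun k : 'I_m => nth i0 s k).
  by move=> k l /eqP; rewrite nth_uniq ?sz_s // => /eqP/val_inj.
pose op : (m.-1).-tuple bool := [tuple rs k < rs k.+1 | k < m.-1].
have op_c k : k < m -> count id (take k op) = rs k.
  elim: k => [|k IHk] lt_k; first by rewrite take0 rs0.
  have lt_k' : k < m.-1 by rewrite -ltnS prednK.
  rewrite (take_nth true) ?size_tuple // -cats1 count_cat IHk 1?ltnW //= addn0 rsS //.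
  by have := tnth_mktuple (fun k : 'I_m.-1 => rs k < rs k.+1) (Ordinal lt_k');
    rewrite (tnth_nth true) /= => ->.
exists (perm inj_s, op); apply/eqP; rewrite /expr_blocks.
have opC : count id op = (size P).-1.
  by rewrite -rs_last -op_c ?ltn_predL // take_oversize // size_tuple.
have -> : (count id (perm inj_s, op).2).+1 = size P by rewrite -(prednK P_gt0) -opC.
apply: (@eq_from_nth _ set0); first by rewrite size_map size_iota.
move=> b lt_b; rewrite (nth_map 0) ?size_iota // nth_iota //= add0n.
apply/setP => i; rewrite rE //; apply/idP/imsetP => [/eqP ri|[k]].
  have lt_i : index i s < m by have := mem_s i; rewrite -index_mem sz_s.
  exists (Ordinal lt_i); last by rewrite permE nth_index.
  by rewrite inE op_c //= /rs nth_index // ri.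
by rewrite inE op_c // => /eqP kb ->; rewrite permE; apply/eqP.
Qed.

Definition woc_lt (m : nat) (P : seq {set 'I_m}) (i j : 'I_m) : bool :=
  woc_rank P i < woc_rank P j.

Definition woc_eq (m : nat) (P : seq {set 'I_m}) (i j : 'I_m) : bool :=
  woc_rank P i == woc_rank P j.

Definition woc_stop (m : nat) (P : seq {set 'I_m}) : bool :=
  [exists i1 : 'I_m, exists i2 : 'I_m, exists i3 : 'I_m,
     [&& i1 < i2, i2 < i3,
         woc_lt P i1 i2 || woc_eq P i1 i2 & woc_lt P i2 i3]].

(* The restriction to x_1, ..., x_m of a chain on x_1, ..., x_m.+1, that is, its
   parent in the generating tree. *)
Definition woc_restr (m : nat) (P : seq {set 'I_m.+1}) : seq {set 'I_m} :=
  [seq B <- [seq [set i : 'I_m | widen_ord (leqnSn m) i \in A] | A : {set 'I_m.+1} <- P]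
     | B != set0].

(* A chain is a node of the restricted generating tree when no proper ancestor
   of it contains the stopping condition; the empty chain, at level 0, lies above
   the root x_1 and never contains it. *)
Fixpoint in_tree (m : nat) : seq {set 'I_m} -> bool :=
  match m return seq {set 'I_m} -> bool with
  | 0 => fun=> true
  | m'.+1 => fun P => in_tree (woc_restr P) && ~~ woc_stop (woc_restr P)
  end.

Definition tree_leaves (n m : nat) : {set {bseq m of {set 'I_m}}} :=
  [set P in WOC m | in_tree P & (m == n) || woc_stop P].

Definition woc_count (n : nat) : nat :=
  \sum_(1 <= m < n.+1) #|tree_leaves n m|.

Definition narayana (n d : nat) : rat :=
  (n%:R^-1 * 'C(n, d)%:R * 'C(n, d.+1)%:R)%R.

(* The word s(1) ... s(j) of a permutation of {1, ..., j}. *)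
Definition one_line (j : nat) (s : 'S_j) : seq nat :=
  [seq (s i : nat).+1 | i <- enum 'I_j].

Definition contains213 (u : seq nat) : bool :=
  [exists a : 'I_(size u), exists b : 'I_(size u), exists c : 'I_(size u),
     [&& a < b, b < c, nth 0 u b < nth 0 u a & nth 0 u a < nth 0 u c]].

Definition descents (u : seq nat) : nat :=
  #|[set i : 'I_(size u) | (i.+1 < size u) && (nth 0 u i.+1 < nth 0 u i)]|.

Definition G213 (j d : nat) : {set 'S_j} :=
  [set s : 'S_j | [&& contains213 (one_line s), descents (one_line s) == d
                    & ~~ contains213 (rem j (one_line s))]].

(* Formal power series over a field, with the Cauchy product. *)

Local Open Scope ring_scope.

Record fps (K : fieldType) := Fps { fcoef : nat -> K }.

Section FormalPowerSeries.
Variable K : fieldType.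
Implicit Types f g h : fps K.

HB.instance Definition _ := gen_eqMixin (fps K).
HB.instance Definition _ := gen_choiceMixin (fps K).

Lemma fpsP f g : (forall n, fcoef f n = fcoef g n) <-> f = g.
Proof.
split=> [|-> //]; case: f g => [f] [g] /= efg.
by congr Fps; apply: funext.
Qed.

Definition fps_const (c : K) := Fps (fun n => if n == 0%N then c else 0).
Definition fps_add f g := Fps (fun n => fcoef f n + fcoef g n).
Definition fps_opp f := Fps (fun n => - fcoef f n).
Definition fps_mul f g :=
  Fps (fun n => \sum_(i < n.+1) fcoef f i * fcoef g (n - i)).

Fact fps_addA : associative fps_add.
Proof. by move=> f g h; apply/fpsP => n /=; rewrite addrA. Qed.
Fact fps_addC : commutative fps_add.
Proof. by move=> f g; apply/fpsP => n /=; rewrite addrC. Qed.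
Fact fps_add0 : left_id (fps_const 0) fps_add.
Proof. by move=> f; apply/fpsP => n /=; rewrite if_same add0r. Qed.
Fact fps_addN : left_inverse (fps_const 0) fps_opp fps_add.
Proof. by move=> f; apply/fpsP => n /=; rewrite if_same addNr. Qed.

HB.instance Definition _ :=
  GRing.isZmodule.Build (fps K) fps_addA fps_addC fps_add0 fps_addN.

Let trunc N f : {poly K} := \poly_(i < N) fcoef f i.

Let coef_trunc N f n : (n < N)%N -> (trunc N f)`_n = fcoef f n.
Proof. by move=> lt_nN; rewrite coef_poly lt_nN. Qed.

Let coefM_trunc N f g n :
  (n < N)%N -> (trunc N f * trunc N g)`_n = fcoef (fps_mul f g) n.
Proof.
move=> lt_nN; rewrite coefM; apply: eq_bigr => i _.
rewrite !coef_trunc //; first exact: leq_ltn_trans (leq_subr _ _) lt_nN.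
exact: leq_trans (ltn_ord i) lt_nN.
Qed.

Let eq_coefM N (p p' q q' : {poly K}) n : (n < N)%N ->
  (forall i, (i < N)%N -> p`_i = p'`_i) -> (forall i, (i < N)%N -> q`_i = q'`_i) ->
  (p * q)`_n = (p' * q')`_n.
Proof.
move=> lt_nN ep eq; rewrite !coefM; apply: eq_bigr => i _.
rewrite ep ?eq //; first exact: leq_ltn_trans (leq_subr _ _) lt_nN.
exact: leq_trans (ltn_ord i) lt_nN.
Qed.

Fact fps_mulA : associative fps_mul.
Proof.
move=> f g h; apply/fpsP => n.
rewrite -!(@coefM_trunc n.+1) //.
have E a b i : (i < n.+1)%N ->
    (trunc n.+1 (fps_mul a b))`_i = (trunc n.+1 a * trunc n.+1 b)`_i.
  by move=> lt_i; rewrite coef_trunc // coefM_trunc.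
transitivity ((trunc n.+1 f * (trunc n.+1 g * trunc n.+1 h))`_n).
  by apply: (@eq_coefM n.+1) => // i /E.
by rewrite mulrA; apply: (@eq_coefM n.+1) => // i /E.
Qed.

Fact fps_mulC : commutative fps_mul.
Proof.
by move=> f g; apply/fpsP => n; rewrite -!(@coefM_trunc n.+1) // mulrC.
Qed.

Fact fps_mul1 : left_id (fps_const 1) fps_mul.
Proof.
move=> f; apply/fpsP => n /=.
rewrite big_ord_recl /= mul1r subn0 big1 ?addr0 // => i _.
by rewrite mul0r.
Qed.

Fact fps_mulDl : left_distributive fps_mul fps_add.
Proof.
move=> f g h; apply/fpsP => n /=; rewrite -big_split.
by apply: eq_bigr => i _; rewrite /= mulrDl.
Qed.

Fact fps_1neq0 : fps_const 1 != 0.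
Proof.
apply/eqP => /(congr1 (fun f : fps K => fcoef f 0)) /= /eqP.
by rewrite oner_eq0.
Qed.

HB.instance Definition _ := GRing.Zmodule_isComNzRing.Build (fps K)
  fps_mulA fps_mulC fps_mul1 fps_mulDl fps_1neq0.

(* The sequence whose n-th term is F applied to the list of its first n terms. *)
Definition course_rec (F : seq K -> K) (n : nat) : K :=
  nth 0 (iter n.+1 (fun s => rcons s (F s)) [::]) n.

Lemma course_recE (F : seq K -> K) n :
  course_rec F n = F (mkseq (course_rec F) n).
Proof.
have sz k : size (iter k (fun s => rcons s (F s)) [::]) = k.
  by elim: k => //= k IHk; rewrite size_rcons IHk.
have E k : iter k (fun s => rcons s (F s)) [::] = mkseq (course_rec F) k.
  elim: k => // k IHk; rewrite iterS mkseqS -IHk; congr rcons.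
  by rewrite /course_rec iterS nth_rcons sz ltnn eqxx.
by rewrite {1}/course_rec iterS nth_rcons sz ltnn eqxx E.
Qed.

Definition fps_unit : pred (fps K) := fun f => fcoef f 0 != 0.

Definition fps_inv f : fps K :=
  if fcoef f 0 == 0 then f else
  Fps (course_rec (fun s : seq K => if nilp s then (fcoef f 0)^-1 else
    - (fcoef f 0)^-1 * \sum_(i < size s) s`_i * fcoef f (size s - i))).

Fact fps_mulV : {in fps_unit, left_inverse 1 fps_inv *%R}.
Proof.
move=> f; rewrite unfold_in => nz; apply/fpsP => n.
rewrite /fps_inv (negPf nz).
set F := (X in course_rec X).
rewrite /GRing.mul /= big_ord_recr /= subnn.
rewrite {2}/course_rec -/(course_rec F n) (course_recE F n) {2}/F /nilp size_mkseq.
case: n => [|n] /=; first by rewrite big_ord0 add0r mulVf.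
rewrite mulrAC mulNr mulVf // mulN1r.
apply/eqP; rewrite subr_eq0; apply/eqP; apply: eq_bigr => i _.
by rewrite (nth_mkseq _ (course_rec F)).
Qed.

Fact fps_unitP f g : g * f = 1 -> fps_unit f.
Proof.
move=> /(congr1 (fun h : fps K => fcoef h 0)) /=.
rewrite big_ord_recl big_ord0 addr0 /= => gf1; apply/eqP => f0.
by move/eqP: gf1; rewrite f0 mulr0 eq_sym oner_eq0.
Qed.

Fact fps_inv_out : {in [predC fps_unit], fps_inv =1 id}.
Proof. by move=> f; rewrite !inE unfold_in negbK /fps_inv => ->. Qed.

HB.instance Definition _ := GRing.ComNzRing_hasMulInverse.Build (fps K)
  fps_mulV fps_unitP fps_inv_out.

Definition fpsX : fps K := Fps (fun n => (n == 1%N)%:R).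

(* The square root with constant term 1 of a series with constant term 1. *)
Definition fps_sqrt f : fps K :=
  Fps (course_rec (fun s : seq K => if nilp s then 1 else
    (fcoef f (size s) - \sum_(1 <= i < size s) s`_i * s`_(size s - i)) / 2)).

Lemma fcoef_sqrt0 f : fcoef (fps_sqrt f) 0 = 1.
Proof. by rewrite /= course_recE. Qed.

Lemma fcoef_sqrtS f n : fcoef (fps_sqrt f) n.+1 =
  (fcoef f n.+1 - \sum_(1 <= i < n.+1)
     fcoef (fps_sqrt f) i * fcoef (fps_sqrt f) (n.+1 - i)) / 2.
Proof.
rewrite [LHS]course_recE /nilp size_mkseq; congr ((_ - _) / _).
apply: eq_big_nat => i /andP[i_gt0 lt_i].
rewrite !(nth_mkseq 0) // ltn_subrL i_gt0 //.
Qed.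

Lemma fps_sqrtK f : (2 : K) != 0 -> fcoef f 0 = 1 -> fps_sqrt f ^+ 2 = f.
Proof.
move=> nz2 f0; apply/fpsP => n; rewrite expr2.
have := fcoef_sqrtS f; have := fcoef_sqrt0 f; move: (fps_sqrt f) => g g0 gS /=.
case: n => [|n]; first by rewrite big_ord_recl big_ord0 addr0 /= g0 mulr1.
rewrite big_ord_recl big_ord_recr /= /bump /= subn0 add1n subnn g0.
rewrite mul1r mulr1 gS big_add1 /= big_mkord.
by set S := \sum_(i < n) _; field.
Qed.

End FormalPowerSeries.

Arguments fpsX {K}.

(* Main.v *)
(* A chain on m variables is read as its word of ranks, and x_{m+1} is inserted
   into a chain with k blocks in 2k+1 ways: c joins block c or becomes a new block
   just below it. If the chain avoids the stopping condition, the insertion at c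
   is harmless iff c is at most the least rank t of an x_j with some earlier
   x_i <= x_j. Hence the avoiding chains form a generating tree with labels t, and
   the number of chains whose parent avoids is the sum of 2k+1 over avoiding
   chains. On the permutation side, inserting the maximum into a 213-avoiding
   permutation is harmless iff it happens inside or at the end of the initial
   increasing run, so the avoiding permutations form a generating tree labelled by
   the length of that run.

   Both trees are solved by differencing in the label: with y marking blocks, the
   subtrees of the chain tree below a label e are counted by U^e, where
   U = 1 + x U + x y U^2, and the decreasing chains glue these subtrees into the
   permutation tree for the weights a = y and b = 1 + y. The latter has the closed
   form [perm_tree_ballot], a ballot-type determinant that specializes to the
   Narayana numbers. The weights 2k+1 and 2(n-d)+d+1 of the two sides are matched
   by the derivative at y = 1. The value and the derivative of U at y = 1 satisfy
   algebraic equations in which 1 - x - 2xU is the square root of 1 - 6x + x^2,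
   and these give W. *)
Require Import Defs.
From Stdlib Require Import BinNat.
From HB Require Import structures.
From mathcomp Require Import all_boot all_order all_fingroup all_algebra.
From mathcomp Require Import ring zify.

Set Implicit Arguments.
Unset Strict Implicit.
Unset Printing Implicit Defensive.

Import GRing.Theory.
(** * Generation of rank words by insertion *)

(* Words list the ranks with the most recently inserted variable first. The weak
   tops are the entries x_j such that x_i <= x_j for some earlier x_i. *)
Fixpoint weak_tops (w : seq nat) : seq nat :=
  if w is c :: v then
    if has (fun x => x <= c) v then c :: weak_tops v else weak_tops v
  else [::].

Fixpoint has_stop (w : seq nat) : bool :=
  if w is c :: v then has (fun t => t < c) (weak_tops v) || has_stop v else false.

(* In the pair (k, w), w is a rank word and k its number of blocks. For j < k the
   new variable joins block j, otherwise it forms a new block below block j - k. *)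
Definition insert_last (p : nat * seq nat) (j : nat) : nat * seq nat :=
  if j < p.1 then (p.1, j :: p.2)
  else (p.1.+1, (j - p.1) :: [seq bump (j - p.1) x | x <- p.2]).

Fixpoint rank_words (m : nat) : seq (nat * seq nat) :=
  if m is m'.+1 then
    [seq insert_last p j | p <- rank_words m', j <- iota 0 p.1.*2.+1]
  else [:: (0, [::])].

Lemma mem_map_bump c x (w : seq nat) :
  (x \in [seq bump c y | y <- w]) = (x != c) && (unbump c x \in w).
Proof.
apply/mapP/andP => [[y wy ->]|[ne_x wx]]; last by exists (unbump c x); rewrite ?unbumpK.
by rewrite bumpK eq_sym neq_bump.
Qed.

(** Insertion is undone by removing the head. If the head recurs in the tail, the new variable had
    joined its block; otherwise it had formed a block of its own, and [unbump] closes the gap. *)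
Lemma mem_rank_words m k w :
  (k, w) \in rank_words m <-> size w = m /\ w =i iota 0 k.
Proof.
elim: m k w => [|m IHm] k w.
  rewrite inE; split=> [/eqP[-> ->] //|[/size0nil-> wE]].
  by case: k wE => // k /(_ 0); rewrite inE.
split=> [/allpairsPdep[[k0 w0] [j [/IHm[sz_w0 w0E]]]]|].
  rewrite mem_iota /= add0n /insert_last /= => lt_j.
  case: ltnP => [lt_jk|le_kj] [-> ->] /=.
    split=> [|x]; first by rewrite sz_w0.
    by rewrite inE w0E mem_iota; case: eqP => // ->.
  split=> [|x]; first by rewrite size_map sz_w0.
  rewrite inE mem_map_bump w0E -[0 :: _]/(iota 0 k0.+1) !mem_iota /unbump.
  by case: ltngtP => /=; lia.
case: w => [[]//|c v [[sz_v] wE]]; apply/allpairsPdep.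
have lt_ck : c < k by have := wE c; rewrite mem_head mem_iota.
have [vc|v'c] := boolP (c \in v).
  exists (k, v), c; split; last by rewrite /insert_last lt_ck.
    by apply/IHm; split=> // x; rewrite -wE inE; case: eqP => // ->.
  by rewrite mem_iota /=; lia.
case: k lt_ck wE => // k; rewrite ltnS => le_ck wE.
have bumpK' : [seq bump c x | x <- [seq unbump c x | x <- v]] = v.
  rewrite -map_comp -[RHS]map_id; apply/eq_in_map => x vx /=.
  by apply: unbumpK; rewrite inE; apply: contraNneq v'c => <-.
exists (k, [seq unbump c x | x <- v]), (k + c); split.
- apply/IHm; split=> [|x]; first by rewrite size_map.
  have := wE (bump c x); rewrite inE eq_sym (negPf (neq_bump _ _)) /=.
  rewrite -{1}bumpK' mem_map ?mem_iota; last exact: can_inj (bumpK c).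
  rewrite -[0 :: _]/(iota 0 k.+1) mem_iota => ->; rewrite /bump.
  by case: leqP => /=; lia.
- by rewrite mem_iota /=; lia.
- by rewrite /insert_last /= ltnNge leq_addr /= addKn bumpK'.
Qed.

Lemma rank_words_uniq m : uniq (rank_words m).
Proof.
elim: m => // m IHm; apply: (@allpairs_uniq_dep _ (fun=> nat)) => // [p _|]; first exact: iota_uniq.
move=> _ _ /allpairsPdep[[k w] [j [pm _ ->]]] /allpairsPdep[[k' w'] [j' [pm' _ ->]]] /=.
case/mem_rank_words: pm => _ wE; case/mem_rank_words: pm' => _ wE'.
rewrite /insert_last /=; case: ltnP => [lt_j|le_j]; case: ltnP => [lt_j'|le_j'] [].
- by move=> -> -> ->.
- move=> _ jE w_eq; have := wE j; rewrite mem_iota lt_j w_eq mem_map_bump jE.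
  by rewrite eqxx.
- move=> _ jE w_eq; have := wE' j'; rewrite mem_iota lt_j' -w_eq mem_map_bump jE.
  by rewrite eqxx.
move=> eq_k eq_c; rewrite eq_k in le_j eq_c * => eq_w.
have -> : j = j' by rewrite -(subnK le_j) eq_c subnK.
by move: eq_w; rewrite eq_c => /(inj_map (can_inj (bumpK _)))->.
Qed.

Lemma weak_tops_sub w : {subset weak_tops w <= w}.
Proof.
elim: w => //= c v IHv x.
by case: ifP => _ => [/predU1P[->|/IHv vx]|/IHv vx]; rewrite ?mem_head // inE vx orbT.
Qed.

Lemma weak_tops_bump c w :
  weak_tops [seq bump c x | x <- w] = [seq bump c x | x <- weak_tops w].
Proof.
elim: w => //= a v ->; rewrite has_map (eq_has (a2 := fun x => x <= a)); last first.
  by move=> x /=; rewrite leq_bump2.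
by case: ifP.
Qed.

(** [bump c] fixes the values below [c] and keeps all others at least [c], so a new block at [c] is
    compared with the weak tops exactly as joining block [c] is. *)
Lemma has_lt_bump c w : has (fun t => t < c) [seq bump c x | x <- w] = has (fun t => t < c) w.
Proof. by rewrite has_map; apply: eq_has => x; rewrite /= /bump; case: leqP => /=; lia. Qed.

Lemma has_stop_bump c w : has_stop [seq bump c x | x <- w] = has_stop w.
Proof.
elim: w => //= a v ->; congr (_ || _); rewrite weak_tops_bump has_map.
by apply: eq_has => x /=; rewrite !ltnNge leq_bump2.
Qed.

Local Open Scope ring_scope.

(** * Generating trees *)

(* The weighted number of avoiding chains n levels below a chain whose least weak
   top is e - 1, divided by the weight of that chain; y marks the blocks. *)
Fixpoint chain_tree (R : comNzRingType) (y : R) (n e : nat) : R :=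
  if n is n'.+1 then
    \sum_(c < e) (chain_tree y n' c.+1 + y * chain_tree y n' c.+2)
  else 1.

(* The same for the chain x_k < ... < x_1, the only kind without weak tops: its
   subtree is that of a chain of label k, except for the child
   x_k.+1 < x_k < ... < x_1. *)
Fixpoint decr_tree (R : comNzRingType) (y : R) (n k : nat) : R :=
  if n is n'.+1 then chain_tree y n k + y * decr_tree y n' k.+1 else 1.

(* For a = 1 and b = z, the number of 213-avoiding permutations n levels below one
   whose initial increasing run has length i, with z marking the new descents. *)
Fixpoint perm_tree (R : comNzRingType) (a b : R) (n i : nat) : R :=
  if n is n'.+1 then
    a * perm_tree a b n' i.+1 + b * \sum_(c < i) perm_tree a b n' c.+1
  else 1.

Arguments chain_tree : simpl never.
Arguments decr_tree : simpl never.
Arguments perm_tree : simpl never.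

Section Trees.
Variable R : comNzRingType.
Implicit Types (y a b : R) (n e i : nat).

Lemma chain_treeS y n e :
  chain_tree y n.+1 e.+1 =
    chain_tree y n.+1 e + (chain_tree y n e.+1 + y * chain_tree y n e.+2).
Proof. by rewrite {1}/chain_tree -/chain_tree big_ord_recr. Qed.

Lemma perm_treeS a b n i :
  perm_tree a b n.+1 i.+1 - perm_tree a b n.+1 i =
    a * (perm_tree a b n i.+2 - perm_tree a b n i.+1) + b * perm_tree a b n i.+1.
Proof. by rewrite {1 2}/perm_tree -/perm_tree big_ord_recr /=; ring. Qed.

(* The generating function of the n |-> chain_tree y n e is the e-th power of the
   one for e = 1. *)
Lemma chain_tree_mul y n e f :
  chain_tree y n (e + f) = \sum_(k < n.+1) chain_tree y k e * chain_tree y (n - k) f.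
Proof.
elim: n e f => [|n IHn] e f; first by rewrite big_ord1 mulr1.
elim: e => [|e IHe].
  rewrite big_ord_recl big1 ?addr0 ?mul1r // => k _.
  by rewrite lift0 /chain_tree big_ord0 mul0r.
rewrite addSn chain_treeS IHe -addSn -addSn !IHn big_ord_recl [RHS]big_ord_recl -addrA.
congr (_ + _); rewrite mulr_sumr -!big_split; apply: eq_bigr => k _.
by rewrite !lift0 !subSS chain_treeS /=; ring.
Qed.

(** By [chain_treeS] the right-hand side satisfies the recursion of [decr_tree]. Read backwards,
    each pair of terms in [chain_tree] is [1 + y] times one [decr_tree], which turns the latter into
    a [perm_tree]. *)
Lemma decr_tree_chain y n i :
  (1 + y) * decr_tree y n i = chain_tree y n i + y * chain_tree y n i.+1.
Proof.
elim: n i => [|n IHn] i; first by rewrite /decr_tree /chain_tree; ring.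
rewrite chain_treeS -[decr_tree y n.+1 i]/(chain_tree y n.+1 i + y * decr_tree y n i.+1).
have := IHn i.+1; move: (chain_tree y n.+1 i) (decr_tree _ _ _) => A B E.
by rewrite -E; ring.
Qed.

Lemma decr_tree_perm y n i : decr_tree y n i = perm_tree y (1 + y) n i.
Proof.
elim: n i => // n IHn i; rewrite /decr_tree -/decr_tree /perm_tree -/perm_tree -IHn addrC mulr_sumr.
by congr (_ + _); apply: eq_bigr => c _; rewrite -IHn decr_tree_chain.
Qed.

(* The coefficient of z^d T^n in (1 + T)^n (1 + z T)^m (1 - z T^2), as given by
   Lagrange inversion. *)
Definition ballot (m n d : nat) : R :=
  'C(m, d)%:R * 'C(n, d)%:R - (if d is d'.+1 then 'C(m, d')%:R * 'C(n, d.+1)%:R else 0).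

Lemma ballotS m n d :
  ballot m.+1 n.+1 d.+1 - ballot m n.+1 d.+1 = ballot m n d + ballot m.+1 n d.+1 - ballot m n d.+1.
Proof.
case: d => [|d]; rewrite /ballot !binS ?bin0 ?natrD; ring.
Qed.

(** Both sides have the same first differences in [i], by [perm_treeS] and [ballotS]; only the base
    [i = 0] needs a separate binomial computation. *)
Lemma perm_tree_ballot a b n i :
  perm_tree a b n i.+1 = \sum_(d < n.+1) ballot (n + i) n d * a ^+ (n - d) * b ^+ d.
Proof.
elim: n i => [|n IHn] i.
  by rewrite big_ord1 /ballot /perm_tree /= !bin0 !expr0; ring.
have shift f : b * (\sum_(d < n.+1) f d * a ^+ (n - d) * b ^+ d) =
    \sum_(d < n.+1) f d * a ^+ (n.+1 - d.+1) * b ^+ d.+1.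
  by rewrite mulr_sumr; apply: eq_bigr => d _; rewrite exprS subSS; ring.
have extend m : a * (\sum_(d < n.+1) ballot m n d * a ^+ (n - d) * b ^+ d) =
    \sum_(d < n.+2) ballot m n d * a ^+ (n.+1 - d) * b ^+ d.
  (* The two binomials over [n] vanish at [n.+1], so a null top term aligns the ranges of
     summation. *)
  have bal0 : ballot m n n.+1 = 0 by rewrite /ballot (@bin_small n) // (@bin_small n) //; ring.
  rewrite [RHS]big_ord_recr /= bal0 !mul0r addr0.
  rewrite mulr_sumr; apply: eq_bigr => d _.
  by rewrite subSn ?exprS -1?ltnS //; ring.
elim: i => [|i IHi].
  rewrite {1}/perm_tree -/perm_tree big_ord1 !IHn extend shift big_ord_recl.
  rewrite [RHS]big_ord_recl -addrA.
  congr (_ + _); first by rewrite /ballot !bin0.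
  rewrite -big_split; apply: eq_bigr => d _; rewrite !lift0 /= -!mulrDl.
  congr (_ * _ * _); rewrite addn0 addn1 addn0.
  case: (d : nat) => [|d']; rewrite /ballot !binS ?bin0 ?natrD; ring.
rewrite -[LHS](subrK (perm_tree a b n.+1 i.+1)) perm_treeS IHi !IHn mulrBr !extend shift.
have recl m k : \sum_(d < n.+2) ballot m k d * a ^+ (n.+1 - d) * b ^+ d =
    a ^+ n.+1 + \sum_(d < n.+1) ballot m k d.+1 * a ^+ (n.+1 - d.+1) * b ^+ d.+1.
  by rewrite big_ord_recl /= /ballot !bin0 subr0 !mulr1 mul1r.
rewrite !recl.
set s1 := \sum_(d < n.+1) _; set s2 := \sum_(d < n.+1) _; set s3 := \sum_(d < n.+1) _.
set s4 := \sum_(d < n.+1) _; set s5 := \sum_(d < n.+1) _.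
suff -> : s5 = s1 - s2 + s3 + s4 by ring.
rewrite /s5 /s1 /s2 /s3 /s4 -sumrB -!big_split; apply: eq_bigr => d _ /=.
rewrite -!mulrBl -!mulrDl; congr (_ * _ * _).
rewrite !addSn !addnS -[LHS](subrK (ballot (n + i).+1 n.+1 d.+1)) ballotS; ring.
Qed.

End Trees.

Lemma narayana_ballot n d : narayana n.+1 d = ballot rat n n d.
Proof.
have e1 : (d.+1%:R * 'C(n.+1, d.+1)%:R = n.+1%:R * 'C(n, d)%:R :> rat).
  by rewrite -!natrM mul_bin_diag.
have [lt_nd|le_dn] := ltnP n d.
  rewrite /narayana /ballot (@bin_small n.+1 d.+1) // (@bin_small n d) //.
  case: d {e1} lt_nd => // d lt_nd; have := leqW lt_nd => lt'.
  rewrite (bin_small lt'). by rewrite !mulr0 subrr.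
have e2 : (d.+1%:R * 'C(n, d.+1)%:R = (n%:R - d%:R) * 'C(n, d)%:R :> rat).
  by rewrite -natrB // -!natrM mul_bin_left.
have nz k : k.+1%:R != 0 :> rat by rewrite Num.Theory.pnatr_eq0.
apply: (mulfI (nz n)); apply: (mulfI (nz d)).
have -> : n.+1%:R * narayana n.+1 d = 'C(n.+1, d)%:R * 'C(n.+1, d.+1)%:R.
  by rewrite /narayana !mulrA mulfV // mul1r.
rewrite mulrCA e1.
case: d le_dn e1 e2 => [|d] le_dn e1 e2; first by rewrite /ballot !bin0; ring.
have e3 : (d.+1%:R * 'C(n, d.+1)%:R = (n%:R - d%:R) * 'C(n, d)%:R :> rat).
  by rewrite -natrB ?(ltnW le_dn) // -!natrM mul_bin_left.
rewrite /ballot binS natrD.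
move: e2 e3; move: 'C(n, d)%:R 'C(n, d.+1)%:R 'C(n, d.+2)%:R => B A E e2 e3.
(* With [B], [A], [E] three consecutive binomials, the difference is a combination of the absorption
   relations [e2] and [e3]. *)
apply/eqP; rewrite -subr_eq0 (_ : _ - _ = n.+1%:R * B * (d.+2%:R * E - (n%:R - d.+1%:R) * A)
  - n.+1%:R * A * (d.+1%:R * A - (n%:R - d%:R) * B)); last by ring.
by rewrite e2 e3 !subrr !mulr0 subrr.
Qed.

(** * Avoiding rank words *)

Lemma foldr_minn_id c (T : seq nat) : all (leq c) T -> foldr minn c T = c.
Proof. by elim: T => //= x T IHT /andP[le_cx /IHT->]; apply/minn_idPr. Qed.

Lemma has_lt_minn c t T : has (fun x => x < c)%N (t :: T) = (foldr minn t T < c)%N.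
Proof.
elim: T => [|x T IHT] /=; first by rewrite orbF.
by rewrite gtn_min -IHT /= orbCA.
Qed.

Lemma foldr_minn_mem t T : foldr minn t T \in t :: T.
Proof.
elim: T => [|x T IHT] /=; first exact: mem_head.
rewrite minnE; move: IHT; set m := foldr _ _ _ => IHT.
have [le_xm|lt_mx] := leqP x m.
  by rewrite (eqnP le_xm) subn0 !inE eqxx orbT.
by rewrite subKn 1?ltnW // !inE; move: IHT; rewrite inE => /orP[->|->]; rewrite ?orbT.
Qed.

Lemma foldr_minnS t T : foldr minn t.+1 [seq bump 0 x | x <- T] = (foldr minn t T).+1.
Proof. by elim: T => //= x T ->; rewrite /bump add1n minnSS. Qed.

(** A potential: the weighted number of avoiding descendants [n] levels below. A least weak top [t]
    gives the label [t.+1]. *)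
Definition node_weight (R : comNzRingType) (y : R) n (p : nat * seq nat) : R :=
  y ^+ p.1 * (if weak_tops p.2 is t :: T then chain_tree y n (foldr minn t T).+1
              else decr_tree y n p.1).

Section ChainCount.
Variables (R : comNzRingType) (y : R).

Lemma big_insert_last (P : pred (nat * seq nat)) (F : nat * seq nat -> R) k w :
  \sum_(j <- iota 0 k.*2.+1 | P (insert_last (k, w) j)) F (insert_last (k, w) j) =
    \sum_(c < k | P (k, (c : nat) :: w)) F (k, (c : nat) :: w)
    + \sum_(c < k.+1 | P (k.+1, (c : nat) :: [seq bump c x | x <- w]))
         F (k.+1, (c : nat) :: [seq bump c x | x <- w]).
Proof.
rewrite -addnn -addnS iotaD big_cat; congr (_ + _).
  rewrite -{1}[k]subn0 -/(index_iota 0 k) big_mkord.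
  by apply: eq_big => c; rewrite /insert_last /= ltn_ord.
rewrite add0n -[X in iota X]addn0 iotaDl big_map -{1}[k.+1]subn0 -/(index_iota 0 k.+1) big_mkord.
by apply: eq_big => c; rewrite /insert_last /= ltnNge leq_addr /= addKn.
Qed.

(** An insertion at [c] is harmless iff no weak top lies below [c]. Then [c] becomes the least weak
    top itself, except as a new lowest block, which only shifts the old weak tops up by one. *)
Lemma node_weight_children n k w : w =i iota 0 k -> ~~ has_stop w ->
  \sum_(j <- iota 0 k.*2.+1 | ~~ has_stop (insert_last (k, w) j).2)
     node_weight y n (insert_last (k, w) j) = node_weight y n.+1 (k, w).
Proof.
move=> wE nstop_w; rewrite (big_insert_last (fun p => ~~ has_stop p.2)) /=.
have has_le c : (c < k)%N -> has (fun x => x <= c)%N w.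
  by move=> lt_ck; apply/hasP; exists c; rewrite ?wE ?mem_iota.
have has_leb c : (c < k.+1)%N -> has (fun x => x <= c)%N [seq bump c x | x <- w] = (0 < c)%N.
  move=> le_ck; apply/hasP/idP => [[x]|c_gt0].
    rewrite mem_map_bump => /andP[ne_xc _] le_xc; lia.
  exists 0%N => //; rewrite mem_map_bump eq_sym -lt0n c_gt0 wE mem_iota /unbump; lia.
have nstop_eq (c : 'I_k) : ~~ has_stop ((c : nat) :: w) = ~~ has (fun t => t < c)%N (weak_tops w).
  by rewrite /= (negPf nstop_w) orbF.
have nstop_gap (c : 'I_k.+1) : ~~ (has (fun t => t < c)%N (weak_tops [seq bump c x | x <- w])
     || has_stop [seq bump c x | x <- w]) = ~~ has (fun t => t < c)%N (weak_tops w).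
  by rewrite weak_tops_bump has_lt_bump has_stop_bump (negPf nstop_w) orbF.
rewrite (eq_bigl _ _ nstop_eq) (eq_bigl _ _ nstop_gap) {nstop_eq nstop_gap}.
rewrite {3}/node_weight /=; case def_T: (weak_tops w) => [|t T].
  (* The new lowest block, [c = 0], is the one child that again has no weak tops. *)
  rewrite /= big_ord_recl /=.
  have -> : \sum_(c < k) node_weight y n (k, (c : nat) :: w) =
      y ^+ k * \sum_(c < k) chain_tree y n c.+1.
    rewrite mulr_sumr; apply: eq_bigr => c _.
    by rewrite /node_weight /= has_le ?ltn_ord // def_T.
  have -> : \sum_(c < k) node_weight y n (k.+1, bump 0 c :: [seq bump (bump 0 c) x | x <- w]) =
      y ^+ k.+1 * \sum_(c < k) chain_tree y n c.+2.
    rewrite mulr_sumr; apply: eq_bigr => c _.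
    by rewrite /node_weight /= has_leb ?weak_tops_bump ?def_T // ltnS.
  rewrite {1}/node_weight /= has_leb // weak_tops_bump def_T /=.
  rewrite /decr_tree -/decr_tree /chain_tree -/chain_tree big_split -mulr_sumr exprS /=; ring.
have := foldr_minn_mem t T; have hasE := has_lt_minn _ t T; move: hasE.
set l := foldr minn t T => hasE l_in.
have lt_lk : (l < k)%N.
  by have := @weak_tops_sub w; rewrite def_T => /(_ _ l_in); rewrite wE mem_iota.
have nhasE c : ~~ has (fun x => x < c)%N (t :: T) = (c < l.+1)%N by rewrite hasE -leqNgt.
have min_id c : (c < l.+1)%N -> foldr minn c (t :: T) = c.
  rewrite -nhasE -all_predC => /allP le_cT; apply: foldr_minn_id.
  by apply/allP => x /le_cT /=; rewrite -leqNgt.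
have min_id' c : (c < l.+1)%N -> foldr minn c [seq bump c x | x <- t :: T] = c.
  rewrite -nhasE -(has_lt_bump c (t :: T)) -all_predC => /allP le_cT; apply: foldr_minn_id.
  by apply/allP => x /le_cT /=; rewrite -leqNgt.
have -> : \sum_(c < k | ~~ has (fun x => x < c)%N (t :: T)) node_weight y n (k, (c : nat) :: w) =
    y ^+ k * \sum_(c < l.+1) chain_tree y n c.+1.
  rewrite (eq_bigl (fun c : 'I_k => (c < l.+1)%N)); last by move=> c; exact: nhasE.
  rewrite mulr_sumr (big_ord_widen k (fun c => y ^+ k * chain_tree y n c.+1)) //.
  by apply: eq_bigr => c le_cl; rewrite /node_weight /= has_le // def_T min_id.
have -> : \sum_(c < k.+1 | ~~ has (fun x => x < c)%N (t :: T))
      node_weight y n (k.+1, (c : nat) :: [seq bump c x | x <- w]) =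
    y ^+ k.+1 * \sum_(c < l.+1) chain_tree y n c.+2.
  rewrite (eq_bigl (fun c : 'I_k.+1 => (c < l.+1)%N)); last by move=> c; exact: nhasE.
  rewrite -(big_ord_widen k.+1
    (fun c => node_weight y n (k.+1, (c : nat) :: [seq bump c x | x <- w]))); last exact: ltnW.
  (* The new lowest block moves the least weak top from [l] to [l.+1] and so yields the last term on
     the right; a block at [c.+1] yields the term of index [c]. *)
  rewrite big_ord_recl /= [in RHS]big_ord_recr /= addrC mulrDr mulr_sumr; congr (_ + _).
    by rewrite /node_weight /= has_leb // weak_tops_bump def_T /= -[bump 0 t]/t.+1 foldr_minnS.
  apply: eq_bigr => c _; have le_cl := ltn_ord c.
  rewrite /node_weight /= has_leb ?weak_tops_bump ?def_T; last by rewrite /bump; lia.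
  by have /= -> := min_id' c.+1 le_cl.
by rewrite {3}/chain_tree -/chain_tree big_split -mulr_sumr exprS /=; ring.
Qed.

Lemma big_rank_words_S (F : nat * seq nat -> R) (P : pred (nat * seq nat)) m :
  \sum_(p <- rank_words m.+1 | P p) F p =
    \sum_(p <- rank_words m)
      \sum_(j <- iota 0 p.1.*2.+1 | P (insert_last p j)) F (insert_last p j).
Proof.
rewrite big_mkcond (@big_allpairs_dep _ _ _ _ (fun=> nat) _ insert_last (rank_words m)
  (fun p => iota 0 p.1.*2.+1)) /=; apply: eq_bigr => p _.
by rewrite [RHS]big_mkcond.
Qed.

Lemma has_stop_insert k w j : has_stop w -> has_stop (insert_last (k, w) j).2.
Proof.
move=> stop_w; rewrite /insert_last; case: ifP => _ /=; first by rewrite stop_w orbT.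
by rewrite has_stop_bump stop_w orbT.
Qed.

Lemma node_weight_level n m :
  \sum_(p <- rank_words m.+1 | ~~ has_stop p.2) node_weight y n p =
    \sum_(p <- rank_words m | ~~ has_stop p.2) node_weight y n.+1 p.
Proof.
rewrite (big_rank_words_S _ (fun p => ~~ has_stop p.2)) [RHS]big_mkcond.
apply: eq_big_seq => -[k w] /mem_rank_words[_ wE] /=.
case: ifPn => [nstop_w|]; first exact: node_weight_children.
by rewrite negbK => stop_w; apply: big1 => j; rewrite has_stop_insert.
Qed.

Lemma sum_avoiding_chains n :
  \sum_(p <- rank_words n | ~~ has_stop p.2) y ^+ p.1 = decr_tree y n 0.
Proof.
have node0 p : node_weight y 0 p = y ^+ p.1.
  by rewrite /node_weight; case: (weak_tops _) => *; rewrite mulr1.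
rewrite -(eq_bigr _ (fun p _ => node0 p)).
have step d : (d <= n)%N -> \sum_(p <- rank_words n | ~~ has_stop p.2) node_weight y 0 p =
    \sum_(p <- rank_words (n - d) | ~~ has_stop p.2) node_weight y d p.
  elim: d => [|d IHd] lt_dn; first by rewrite subn0.
  by rewrite (IHd (ltnW lt_dn)) -subnSK // node_weight_level.
by rewrite (step n) // subnn big_cons big_nil /node_weight /= addr0 mul1r.
Qed.

(** The tail of a word is its parent up to [bump], which does not affect the stopping condition; so
    all [2k+1] children of an avoiding word are counted, and no others. *)
Lemma count_chain_children m :
  (count (fun p => ~~ has_stop (behead p.2)) (rank_words m.+1))%:R =
    \sum_(p <- rank_words m | ~~ has_stop p.2) (p.1.*2.+1)%:R :> R.
Proof.
rewrite -sum1_count natr_sum (big_rank_words_S _ (fun p => ~~ has_stop (behead p.2))).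
rewrite [RHS]big_mkcond; apply: eq_bigr => -[k w] _; rewrite [_.2]/= [_.1]/=.
rewrite (eq_bigl (fun=> ~~ has_stop w)) => [|j]; last first.
  by rewrite /insert_last; case: ifP => _ //=; rewrite has_stop_bump.
by case: ifP => _; rewrite ?big_pred0_eq // big_const_seq count_predT size_iota iter_addr addr0.
Qed.

End ChainCount.

(** * Weak-ordering chains as rank words *)

Lemma mem_weak_tops (r : nat -> nat) m t :
  reflect (exists i j, [/\ (i < j < m)%N, (r i <= r j)%N & r j = t])
    (t \in weak_tops (rev (mkseq r m))).
Proof.
apply: (iffP idP); elim: m => [|m IHm].
- by [].
- rewrite mkseqS rev_rcons /=; case: ifP => [/hasP[x]|_]; last first.
    by case/IHm => i [j [lt_ij le_r eq_t]]; exists i, j; split=> //; lia.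
  rewrite mem_rev => /mapP[i]; rewrite mem_iota => lt_im -> le_r.
  rewrite inE => /predU1P[->|/IHm[i' [j [lt_ij le_r' eq_t]]]].
    by exists i, m; split=> //; lia.
  by exists i', j; split=> //; lia.
- by case=> i [j [lt_ij]]; lia.
case=> i [j [lt_ij le_r eq_t]]; rewrite mkseqS rev_rcons /=.
have [eq_jm|ne_jm] := eqVneq j m.
  rewrite ifT -?eq_t ?eq_jm ?mem_head //; apply/hasP; exists (r i); last by rewrite -eq_jm.
  by rewrite mem_rev; apply: map_f; rewrite mem_iota; lia.
have in_m : t \in weak_tops (rev (mkseq r m)) by apply: IHm; exists i, j; split=> //; lia.
by case: ifP => _; rewrite // inE in_m orbT.
Qed.

Lemma has_stopP (r : nat -> nat) m :
  reflect (exists i j k, [/\ (i < j)%N, (j < k < m)%N, (r i <= r j)%N & (r j < r k)%N])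
    (has_stop (rev (mkseq r m))).
Proof.
apply: (iffP idP); elim: m => [|m IHm].
- by [].
- rewrite mkseqS rev_rcons /= => /orP[/hasP[_ /mem_weak_tops[i [j [lt_ij le_r <-]]] lt_r]|/IHm].
    by exists i, j, m; split=> //; lia.
  by case=> i [j [k [lt_ij lt_jk le_r lt_r]]]; exists i, j, k; split=> //; lia.
- by case=> i [j [k [_ lt_jk _ _]]]; lia.
case=> i [j [k [lt_ij lt_jk le_r lt_r]]]; rewrite mkseqS rev_rcons /=.
apply/orP; have [eq_km|ne_km] := eqVneq k m.
  left; apply/hasP; exists (r j); last by rewrite -eq_km.
  by apply/mem_weak_tops; exists i, j; split=> //; lia.
by right; apply: IHm; exists i, j, k; split=> //; lia.
Qed.

Lemma has_stop_order (r r' : nat -> nat) m :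
  (forall i j, (i < m)%N -> (j < m)%N -> (r i <= r j)%N = (r' i <= r' j)%N) ->
  has_stop (rev (mkseq r m)) = has_stop (rev (mkseq r' m)).
Proof.
move=> eq_rr'; apply/has_stopP/has_stopP => -[i [j [k [lt_ij lt_jk le_r lt_r]]]].
  by exists i, j, k; split; rewrite // 1?ltnNge -eq_rr' -?ltnNge //; lia.
by exists i, j, k; split; rewrite // 1?ltnNge eq_rr' -?ltnNge //; lia.
Qed.

Lemma has_stop_behead w : has_stop (behead w) -> has_stop w.
Proof. by case: w => //= c w ->; rewrite orbT. Qed.

Definition rank_word (m : nat) (P : seq {set 'I_m}) : seq nat :=
  rev [seq woc_rank P i | i <- enum 'I_m].

(** Extending the ranks to [nat] with default 0 makes rank words [mkseq]s, whose last variable is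
    split off by [mkseqS]. *)
Definition rank_fun (m : nat) (P : seq {set 'I_m}) (i : nat) : nat :=
  oapp (woc_rank P) 0%N (insub i).

Lemma rank_fun_ord m (P : seq {set 'I_m}) (i : 'I_m) : rank_fun P i = woc_rank P i.
Proof. by rewrite /rank_fun valK. Qed.

Lemma rank_wordE m (P : seq {set 'I_m}) : rank_word P = rev (mkseq (rank_fun P) m).
Proof.
rewrite /rank_word /mkseq -val_enum_ord -map_comp; congr rev.
by apply: eq_map => i; rewrite /= rank_fun_ord.
Qed.

Lemma woc_stopE m (P : seq {set 'I_m}) : woc_stop P = has_stop (rank_word P).
Proof.
rewrite rank_wordE; apply/existsP/has_stopP => [[i /existsP[j /existsP[k]]]|].
  case/and4P=> lt_ij lt_jk; rewrite /woc_lt /woc_eq -!rank_fun_ord => le_r lt_r.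
  by exists i, j, k; split; rewrite ?lt_jk ?ltn_ord // leq_eqVlt orbC.
case=> i [j [k [lt_ij /andP[lt_jk lt_km] le_r lt_r]]].
have lt_jm := ltn_trans lt_jk lt_km; have lt_im := ltn_trans lt_ij lt_jm.
exists (Ordinal lt_im); apply/existsP; exists (Ordinal lt_jm).
apply/existsP; exists (Ordinal lt_km); rewrite /= lt_ij lt_jk /=.
by rewrite /woc_lt /woc_eq -!rank_fun_ord /= lt_r andbT orbC -leq_eqVlt.
Qed.

(** The discarded elements satisfy neither predicate, so the order of the first hits survives. This
    serves for the empty blocks that a restriction drops. *)
Lemma find_filter_leq (T : Type) (a b q : pred T) (s : seq T) :
  subpred a q -> subpred b q ->
  (find a (filter q s) <= find b (filter q s))%N = (find a s <= find b s)%N.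
Proof.
move=> aq bq; elim: s => //= x s IHs; case: ifPn => [_|nqx] /=.
  by case: (a x) => //; case: (b x).
by rewrite (contraNF (aq x)) // (contraNF (bq x)).
Qed.

(* Only comparisons of ranks matter for the stopping condition, so the word of
   the restriction need not be computed. *)
Lemma woc_restr_order m (P : seq {set 'I_m.+1}) (i j : 'I_m) :
  (woc_rank (woc_restr P) i <= woc_rank (woc_restr P) j)%N =
    (rank_fun P i <= rank_fun P j)%N.
Proof.
have restr_rank (k : 'I_m) : rank_fun P k =
    find (fun B : {set 'I_m} => k \in B)
      [seq [set l : 'I_m | widen_ord (leqnSn m) l \in A] | A : {set 'I_m.+1} <- P].
  rewrite -[k : nat]/(widen_ord (leqnSn m) k : nat) rank_fun_ord /woc_rank find_map.
  by apply: eq_find => A; rewrite /= inE.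
by rewrite /woc_rank /woc_restr find_filter_leq -?restr_rank // => A kA;
  apply/set0Pn; [exists i | exists j].
Qed.

Lemma woc_stop_restr m (P : seq {set 'I_m.+1}) :
  woc_stop (woc_restr P) = has_stop (behead (rank_word P)).
Proof.
rewrite woc_stopE !rank_wordE mkseqS rev_rcons /=; apply: has_stop_order => i j lt_im lt_jm.
by rewrite -(woc_restr_order P (Ordinal lt_im) (Ordinal lt_jm)) -!rank_fun_ord.
Qed.

(** The stopping condition is inherited by extensions, so the condition on all proper ancestors
    reduces to the parent. *)
Lemma in_tree_rank_word m (P : seq {set 'I_m.+1}) :
  in_tree P = ~~ has_stop (behead (rank_word P)).
Proof.
elim: m P => [|m IHm] P.
  by rewrite /= woc_stop_restr rank_wordE mkseqS rev_rcons.
rewrite -[LHS]/(in_tree (woc_restr P) && ~~ woc_stop (woc_restr P)) IHm.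
rewrite -(woc_stop_restr P) woc_stopE andb_idl //.
by apply: contra; apply: has_stop_behead.
Qed.

Section PartitionRanks.
Variables (m : nat) (P : seq {set 'I_m}).
Hypotheses (P_uniq : uniq P) (P_part : partition [set B in P] [set: 'I_m]).

Lemma woc_rank_lt i : (woc_rank P i < size P)%N.
Proof.
case/and3P: P_part => /eqP covP _ _; rewrite -has_find.
have := in_setT i; rewrite -covP => /bigcupP[A]; rewrite inE => PA Ai.
by apply/hasP; exists A.
Qed.

Lemma mem_nth_block b i : (b < size P)%N -> (i \in nth set0 P b) = (woc_rank P i == b).
Proof.
have rin : i \in nth set0 P (woc_rank P i).
  by apply: (nth_find set0 (a := fun B : {set 'I_m} => i \in B)); rewrite has_find woc_rank_lt.
case/and3P: P_part => _ /trivIsetP trP _ lt_b; apply/idP/eqP => [bi|<- //].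
apply/eqP; rewrite -(nth_uniq set0 (woc_rank_lt i) lt_b P_uniq).
apply: contraTT bi => /trP; rewrite !inE !mem_nth ?woc_rank_lt // => /(_ isT isT) dis.
by rewrite (disjointFr dis rin).
Qed.

Lemma woc_rank_onto b : (b < size P)%N -> exists i, woc_rank P i = b.
Proof.
case/and3P: P_part => _ _ P0 lt_b; have : nth set0 P b != set0.
  by apply: contraNneq P0 => <-; rewrite inE mem_nth.
by case/set0Pn => i; rewrite mem_nth_block // => /eqP; exists i.
Qed.

Lemma blocks_of_rank : P = mkseq (fun b => [set i | woc_rank P i == b]) (size P).
Proof.
apply: (@eq_from_nth _ set0) => [|b lt_b]; first by rewrite size_mkseq.
by rewrite nth_mkseq //; apply/setP => i; rewrite inE mem_nth_block.
Qed.

Lemma rank_word_mem : (size P, rank_word P) \in rank_words m.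
Proof.
apply/mem_rank_words; split=> [|b]; first by rewrite size_rev size_map size_enum_ord.
rewrite mem_rev mem_iota add0n /=; apply/mapP/idP => [[i _ ->]|/woc_rank_onto[i <-]].
  exact: woc_rank_lt.
by exists i; rewrite ?mem_enum.
Qed.

End PartitionRanks.

Lemma eq_rank_word m (P Q : seq {set 'I_m}) :
  rank_word P = rank_word Q -> woc_rank P =1 woc_rank Q.
Proof. by move/(inv_inj revK)/eq_in_map => eq_r i; apply: eq_r; rewrite mem_enum. Qed.

(** The chain is recovered as the sequence of level sets of the word; they are nonempty because
    every value below [k] occurs. *)
Lemma rank_word_onto m k w : (k, w) \in rank_words m -> (0 < m)%N ->
  exists2 P : {bseq m of {set 'I_m}}, P \in WOC m & (size P, rank_word P) = (k, w).
Proof.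
case/mem_rank_words => sz_w wE m_gt0.
pose B b := [set i : 'I_m | nth 0%N (rev w) i == b].
have rw_ltk (i : 'I_m) : (nth 0%N (rev w) i < k)%N.
  have : nth 0%N (rev w) i \in w by rewrite -mem_rev mem_nth // size_rev sz_w.
  by rewrite wE mem_iota.
have B_ex b : (b < k)%N -> exists i, i \in B b.
  move=> lt_bk; have : b \in rev w by rewrite mem_rev wE mem_iota.
  move=> /(nthP 0%N)[i]; rewrite size_rev sz_w => lt_im eq_b.
  by exists (Ordinal lt_im); rewrite inE /= eq_b.
have B_inj b b' : (b < k)%N -> B b = B b' -> b = b'.
  by move=> /B_ex[i Bi] eqB; have := Bi; rewrite eqB inE => /eqP <-; move: Bi; rewrite inE => /eqP.
have sz_B : (size (mkseq B k) <= m)%N.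
  rewrite size_mkseq -[k](size_iota 0) -sz_w; apply: uniq_leq_size; first exact: iota_uniq.
  by move=> x; rewrite wE.
have rankB i : woc_rank (mkseq B k) i = nth 0%N (rev w) i.
  have lt_r := rw_ltk i.
  have has_r : has (fun A : {set 'I_m} => i \in A) (mkseq B k).
    by apply/hasP; exists (B (nth 0%N (rev w) i)); rewrite ?inE // map_f // mem_iota.
  have := nth_find set0 has_r; rewrite has_find size_mkseq in has_r.
  by rewrite nth_mkseq // inE => /eqP ->.
exists (Bseq sz_B).
  rewrite WOC_partition //=; apply/andP; split.
    rewrite map_inj_in_uniq ?iota_uniq // => b b'; rewrite !mem_iota => lt_b _.
    exact: B_inj.
  apply/and3P; split.
  - apply/eqP/setP => i; rewrite inE; apply/bigcupP; exists (B (nth 0%N (rev w) i)).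
      by rewrite inE; apply/mapP; exists (nth 0%N (rev w) i); rewrite ?mem_iota ?rw_ltk.
    by rewrite inE.
  - apply/trivIsetP => _ _ /[!inE] /mapP[b _ ->] /mapP[b' _ ->] neB.
    rewrite -setI_eq0; apply: contraNT neB => /set0Pn[i].
    by rewrite !inE => /andP[/eqP-> /eqP->].
  rewrite inE; apply/negP => /mapP[b]; rewrite mem_iota => /B_ex[i Bi] B0.
  by rewrite -B0 inE in Bi.
rewrite /= size_mkseq /rank_word; congr (_, _); apply: (canLR revK).
rewrite (eq_map rankB) (map_comp (nth 0%N (rev w)) val) val_enum_ord -sz_w -size_rev.
exact: mkseq_nth.
Qed.

Lemma perm_rank_words m : (0 < m)%N ->
  perm_eq [seq (size P, rank_word P) | P : {bseq m of {set 'I_m}} <- enum (WOC m)]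
    (rank_words m).
Proof.
move=> m_gt0.
have partP (P : {bseq m of {set 'I_m}}) : P \in WOC m ->
    uniq P /\ partition [set B in (P : seq _)] [set: 'I_m].
  by rewrite WOC_partition // => /andP[].
apply: uniq_perm; last 1 first.
- move=> [k w]; apply/mapP/idP => [[P]|kw_in].
    by rewrite mem_enum => /partP[uP pP] ->; apply: rank_word_mem.
  have [P PW eqP] := rank_word_onto kw_in m_gt0.
  by exists P; rewrite ?mem_enum ?eqP.
- rewrite map_inj_in_uniq ?enum_uniq // => P Q; rewrite !mem_enum.
  move=> /partP[uP pP] /partP[uQ pQ] [eq_sz /eq_rank_word eq_r]; apply: val_inj.
  rewrite /= (blocks_of_rank uP pP) (blocks_of_rank uQ pQ) eq_sz.
  by apply: eq_map => b; apply/setP => i; rewrite !inE eq_r.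
exact: rank_words_uniq.
Qed.

Lemma card_tree_leaves n m : (0 < m)%N ->
  #|tree_leaves n m| =
    count (fun p => ~~ has_stop (behead p.2) && ((m == n) || has_stop p.2)) (rank_words m).
Proof.
case: m => // m m_gt0; rewrite -(seq.permP (perm_rank_words m_gt0)) count_map.
rewrite -size_filter -sum1_card -sum1_size big_filter big_enum_cond.
by apply: eq_bigl => P; rewrite !inE -in_tree_rank_word -woc_stopE.
Qed.

Definition avoiding_chains m := count (fun p => ~~ has_stop p.2) (rank_words m).
Definition chains_over_avoiding m :=
  count (fun p => ~~ has_stop (behead p.2)) (rank_words m).

(** Below level [n] the leaves are the chains over an avoiding parent that do not avoid; at level
    [n] the avoiding ones are leaves too. *)
Lemma woc_countE (R : comNzRingType) n : (0 < n)%N ->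
  (woc_count n)%:R = (avoiding_chains n)%:R
    + \sum_(1 <= m < n.+1) ((chains_over_avoiding m)%:R - (avoiding_chains m)%:R) :> R.
Proof.
move=> n_gt0; rewrite /woc_count natr_sum !big_nat_recr //= [RHS]addrCA; congr (_ + _); last first.
  rewrite card_tree_leaves // eqxx [RHS]addrC subrK; congr _%:R.
  by apply: eq_count => p; rewrite andbT.
apply: eq_big_nat => m /andP[m_gt0 lt_mn]; rewrite card_tree_leaves // (ltn_eqF lt_mn) /=.
apply/eqP; rewrite eq_sym subr_eq -natrD; apply/eqP; congr _%:R.
rewrite /chains_over_avoiding /avoiding_chains; elim: (rank_words m) => //= -[k w] s ->.
rewrite addnACA; congr (_ + _)%N; have := @has_stop_behead w.
by rewrite /=; case: has_stop; case: has_stop => // /(_ isT).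
Qed.

(** * Permutations avoiding 213 *)

Definition insert_at (j x : nat) (w : seq nat) : seq nat := take j w ++ x :: drop j w.

Fixpoint perm_words (n : nat) : seq (seq nat) :=
  if n is n'.+1 then [seq insert_at j n w | w <- perm_words n', j <- iota 0 n]
  else [:: [::]].

Fixpoint des (w : seq nat) : nat :=
  if w is x :: v then (if v is y :: _ then (y < x)%N : nat else 0%N) + des v else 0.

Fixpoint first_run (w : seq nat) : nat :=
  if w is x :: v then (if v is y :: _ then if (x <= y)%N then first_run v else 0 else 0).+1
  else 0.

Lemma nth_insert_at j x w i : (j <= size w)%N ->
  nth 0%N (insert_at j x w) i =
    if (i < j)%N then nth 0%N w i else if i == j then x else nth 0%N w i.-1.
Proof.
move=> le_jw; rewrite nth_cat size_takel //; case: ltngtP => [lt_ij|lt_ji|->].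
- by rewrite nth_take.
- by case: i lt_ji => // i lt_ji; rewrite subSn //= nth_drop subnKC.
- by rewrite subnn.
Qed.

Lemma size_insert_at j x w : size (insert_at j x w) = (size w).+1.
Proof. by rewrite size_cat /= addnS -size_cat cat_take_drop. Qed.

Lemma perm_insert_at j x w : perm_eq (insert_at j x w) (x :: w).
Proof. by rewrite /insert_at -cat1s perm_catCA /= cat_take_drop. Qed.

Lemma rem_insert_at j x w : x \notin w -> rem x (insert_at j x w) = w.
Proof.
move=> w'x; rewrite /insert_at; have : x \notin take j w by apply: contra w'x => /mem_take.
rewrite -[RHS](cat_take_drop j); elim: (take j w) => [|y s IHs] /=; first by rewrite eqxx.
by rewrite inE negb_or eq_sym => /andP[/negPf-> /IHs->].
Qed.

Lemma contains213P (u : seq nat) :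
  reflect (exists a b c, [/\ (a < b)%N, (b < c < size u)%N,
    (nth 0%N u b < nth 0%N u a)%N & (nth 0%N u a < nth 0%N u c)%N]) (contains213 u).
Proof.
apply: (iffP existsP) => [[a /existsP[b /existsP[c /and4P[? lt_bc ? ?]]]]|].
  by exists a, b, c; rewrite lt_bc ltn_ord; split.
case=> a [b [c [lt_ab /andP[lt_bc lt_cu] ba ac]]].
have lt_bu := ltn_trans lt_bc lt_cu; have lt_au := ltn_trans lt_ab lt_bu.
exists (Ordinal lt_au); apply/existsP; exists (Ordinal lt_bu).
by apply/existsP; exists (Ordinal lt_cu); apply/and4P.
Qed.

(** The new maximum can only play the 3 of the pattern, so a new occurrence amounts to an inversion
    among the entries before it. *)
Lemma contains213_insert j x (w : seq nat) : all (fun y => y < x)%N w -> (j <= size w)%N ->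
  contains213 (insert_at j x w) = contains213 w || ~~ sorted leq (take j w).
Proof.
move=> /(all_nthP 0%N) w_ltx le_jw; apply/idP/orP; last first.
  case=> [/contains213P[a [b [c [lt_ab /andP[lt_bc lt_cw] ba ac]]]]|nsorted].
    apply/contains213P; exists (bump j a), (bump j b), (bump j c).
    have nth_b i : nth 0%N (insert_at j x w) (bump j i) = nth 0%N w i.
      rewrite nth_insert_at // eq_sym (negPf (neq_bump _ _)) /bump.
      by case: (leqP j i) => /= [le_ji|lt_ij]; rewrite ?add0n ?lt_ij // add1n ltnNge leqW.
    rewrite !nth_b size_insert_at /bump; split=> //; move: lt_ab lt_bc lt_cw {nth_b ba ac};
    by case: leqP; case: leqP; case: leqP => /=; lia.
  apply: contraR nsorted => ncont; apply/(sortedP 0%N) => i; rewrite size_takel // => lt_ij.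
  have lt_iw := leq_trans lt_ij le_jw.
  rewrite !nth_take ?(ltnW lt_ij) // leqNgt.
  (* An adjacent descent before position [j] forms a 213 with the maximum placed at [j]. *)
  apply: contra ncont => gt_i; apply/contains213P; exists i, i.+1, j.
  rewrite !nth_insert_at // lt_ij (ltnW lt_ij) ltnn eqxx size_insert_at ltnS; split=> //.
  by apply: w_ltx; apply: ltnW.
move/contains213P => [a [b [c [lt_ab /andP[lt_bc]]]]].
rewrite size_insert_at ltnS => le_cw.
have big i : (i <= size w)%N -> (nth 0%N (insert_at j x w) i <= x)%N.
  rewrite nth_insert_at // => le_iw; case: ltngtP => // [lt_ij|lt_ji]; apply: ltnW; apply: w_ltx.
    exact: leq_trans lt_ij le_jw.
  by rewrite prednK //; apply: leq_ltn_trans lt_ji.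
have [->|ne_aj] := eqVneq a j.
  have := big c le_cw; rewrite [nth _ _ j]nth_insert_at // ltnn eqxx; lia.
have [eq_bj|ne_bj] := eqVneq b j.
  have le_aw : (a <= size w)%N by lia.
  have := big a le_aw; rewrite eq_bj [nth _ _ j]nth_insert_at // ltnn eqxx; lia.
have [eq_cj|ne_cj] := eqVneq c j => ba ac.
  have lt_aj : (a < j)%N by lia.
  have lt_bj : (b < j)%N by lia.
  right; apply/negP => srt.
  have := sorted_leq_nth leq_trans leqnn 0%N srt a b; rewrite !inE size_takel // !nth_take //.
  move=> /(_ lt_aj lt_bj (ltnW lt_ab)); move: ba.
  rewrite !nth_insert_at // lt_aj lt_bj; lia.
left; apply/contains213P; exists (unbump j a), (unbump j b), (unbump j c).
have nth_b i : i != j -> nth 0%N (insert_at j x w) i = nth 0%N w (unbump j i).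
  move=> ne_ij; rewrite nth_insert_at // (negPf ne_ij) /unbump; case: ltngtP ne_ij => //=.
    by rewrite subn0.
  by rewrite subn1.
rewrite -!nth_b //; split=> //; rewrite /unbump;
  by case: (ltnP j a); case: (ltnP j b); case: (ltnP j c) => /=; lia.
Qed.

Lemma sorted_take_run j w : (j <= size w)%N -> sorted leq (take j w) = (j <= first_run w)%N.
Proof.
case: j w => [|j] [|x w] //; rewrite /= !ltnS.
elim: w x j => [|y w IHw] x [|j] //=; rewrite ltnS => le_jw.
by case: (leqP x y) => //= _; rewrite ltnS; apply: IHw.
Qed.

Lemma first_run_size w : (first_run w <= size w)%N.
Proof. by elim: w => // x [|y w] //= IHw; case: ifP. Qed.

(** Inside the initial run the maximum breaks an ascent, or is put in front, and adds a descent; at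
    the end of the run it takes over the descent there, if any. *)
Lemma des_insert j x w : all (fun y => y < x)%N w -> (j <= first_run w)%N ->
  des (insert_at j x w) = (des w + (j < first_run w))%N.
Proof.
rewrite /insert_at; elim: w j => [|y [|y' w] IHw] [|j] //.
- by case/andP=> lt_yx _ _; rewrite /= lt_yx.
- by case/andP=> lt_yx _; case: j => //= _; rewrite ltnNge ltnW.
- by case/andP=> lt_yx _ _; rewrite /= lt_yx addnC.
case/andP=> lt_yx lt_wx; case: j => [|j].
  case/andP: (lt_wx) => lt_y'x _ _; rewrite /= [(x < y)%N]ltnNge (ltnW lt_yx) lt_y'x /=.
  by case: (leqP y y') => _; rewrite ?addn0 ?add0n ?addn1 ?add1n.
have := IHw j.+1 lt_wx; rewrite /= !ltnS; case: ifP => [lt_yy'|]; last by [].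
by move=> IH /IH ->; rewrite addnA.
Qed.

Lemma first_run_insert j x w : all (fun y => y < x)%N w -> (j <= first_run w)%N ->
  first_run (insert_at j x w) = j.+1.
Proof.
rewrite /insert_at; elim: w j => [|y [|y' w] IHw] [|j] //.
- by case/andP=> lt_yx _ _; rewrite /= leqNgt lt_yx.
- by case/andP=> lt_yx _; case: j => //= _; rewrite (ltnW lt_yx).
- by case/andP=> lt_yx _ _; rewrite /= leqNgt lt_yx.
case/andP=> lt_yx lt_wx; case: j => [|j].
  by case/andP: lt_wx => lt_y'x _ _; rewrite /= (ltnW lt_yx) [(x <= y')%N]leqNgt lt_y'x.
have := IHw j.+1 lt_wx; rewrite /= !ltnS; case: ifP => // lt_yy' IH le_j.
by rewrite IH.
Qed.

(** The end of the word and the [des w] descents are the positions where inserting the maximum keeps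
    the number of descents; each of the others adds one. *)
Lemma sum_des_insert (R : comNzRingType) (z : R) x w : all (fun y => y < x)%N w ->
  \sum_(0 <= j < (size w).+1) z ^+ des (insert_at j x w) =
    z ^+ des w * (z * ((size w)%:R - (des w)%:R) + (des w)%:R + 1).
Proof.
elim: w => [|y [|y' w] IHw].
- by move=> _; rewrite big_nat1 /=; ring.
- case/andP=> lt_yx _; rewrite /= big_nat_recl // big_nat1 /insert_at /= lt_yx.
  by rewrite ltnNge (ltnW lt_yx) /=; ring.
case/andP=> lt_yx lt_wx; move: {IHw}(IHw lt_wx).
have lt_y'x : (y' < x)%N by case/andP: lt_wx.
rewrite [size (y :: _)]/= -[size (y' :: w)]/((size w).+1) big_nat_recl //.
have -> : des (insert_at 0 x (y' :: w)) = (des (y' :: w)).+1.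
  by rewrite /insert_at /= lt_y'x.
set D := des (y' :: w); set S := \sum_(0 <= i < _) _ => IHw.
rewrite big_nat_recl //.
have -> : des (insert_at 0 x [:: y, y' & w]) = ((y' < y)%N + D).+1.
  by rewrite /insert_at /= lt_yx.
rewrite big_nat_recl //.
have -> : des (insert_at 1 x [:: y, y' & w]) = D.+1.
  by rewrite /insert_at /= ltnNge (ltnW lt_yx) /= lt_y'x.
have -> : \sum_(0 <= i < (size w).+1) z ^+ des (insert_at i.+2 x [:: y, y' & w]) =
    z ^+ (y' < y)%N * S.
  by rewrite /S mulr_sumr; apply: eq_bigr => i _; rewrite -exprD.
have -> : des [:: y, y' & w] = ((y' < y)%N + D)%N by [].
move: IHw; rewrite addrC => /(canRL (addrK _)) ->.
by case: (_ < _)%N; rewrite /= ?add1n ?add0n !exprS ?expr0; ring.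
Qed.

Lemma perm_words_perm n w : (w \in perm_words n) = perm_eq w (iota 1 n).
Proof.
elim: n w => [|n IHn] w.
  by rewrite /= inE; apply/eqP/idP => [->//|]; move/perm_size/size0nil.
have iotaE : perm_eq (iota 1 n.+1) (n.+1 :: iota 1 n).
  by rewrite -[X in iota 1 X]addn1 iotaD perm_catC add1n.
rewrite (permPr iotaE); apply/allpairsPdep/idP => [[w0 [j [w0n _ ->]]]|w_perm].
  by rewrite IHn in w0n; rewrite (permPl (perm_insert_at _ _ _)) perm_cons.
have : n.+1 \in w by rewrite (perm_mem w_perm) mem_head.
move=> w_n; case/splitPr: w_n w_perm => p1 p2 w_perm.
exists (p1 ++ p2), (size p1); rewrite /insert_at take_size_cat // drop_size_cat //.
have w0_perm : perm_eq (p1 ++ p2) (iota 1 n).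
  by move: w_perm; rewrite -cat1s perm_catCA /= perm_cons.
split=> //; first by rewrite IHn.
rewrite mem_iota /= add0n ltnS -[n in (_ <= n)%N](size_iota 1) -(perm_size w0_perm).
by rewrite size_cat leq_addr.
Qed.

Lemma perm_words_size n w : w \in perm_words n -> size w = n.
Proof. by rewrite perm_words_perm => /perm_size->; rewrite size_iota. Qed.

Lemma perm_words_lt n w : w \in perm_words n -> all (fun y => y < n.+1)%N w.
Proof.
rewrite perm_words_perm => /perm_mem w_mem; apply/allP => y.
by rewrite w_mem mem_iota add1n => /andP[].
Qed.

Lemma perm_words_notin n w : w \in perm_words n -> n.+1 \notin w.
Proof. by move=> /perm_words_lt/allP w_lt; apply/negP => /w_lt; rewrite ltnn. Qed.

Lemma perm_words_uniq n : uniq (perm_words n).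
Proof.
elim: n => // n IHn; apply: (@allpairs_uniq_dep _ (fun=> nat)) => // [w _|]; first exact: iota_uniq.
move=> _ _ /allpairsPdep[w [j [wn jn ->]]] /allpairsPdep[w' [j' [wn' jn' ->]]] /= eq_ins.
have eq_w : w = w'.
  by rewrite -(rem_insert_at j (perm_words_notin wn)) eq_ins rem_insert_at ?perm_words_notin.
have idx v k : v \in perm_words n -> k \in iota 0 n.+1 -> index n.+1 (insert_at k n.+1 v) = k.
  move=> vn; rewrite mem_iota => lt_kn; rewrite index_cat ifN.
    by rewrite /= eqxx addn0 size_takel // (perm_words_size vn) -ltnS.
  by apply: contra (perm_words_notin vn); apply: mem_take.
by have := idx w j wn jn; rewrite eq_ins eq_w idx // => ->.
Qed.

Lemma size_perm_words n : size (perm_words n) = n`!.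
Proof.
elim: n => // n IHn.
rewrite -[perm_words n.+1]/([seq insert_at j n.+1 w | w <- perm_words n, j <- _]).
rewrite size_allpairs_dep factS -IHn mulnC (eq_map (fun=> size_iota 0 n.+1)).
by elim: (perm_words n) => //= w s ->; rewrite mulSn.
Qed.

(** Injectivity, one inclusion and the common size [n!] suffice. *)
Lemma perm_one_line n : perm_eq [seq one_line s | s <- enum 'S_n] (perm_words n).
Proof.
have inj : injective (@one_line n).
  move=> s t /eq_in_map eq_st; apply/permP => i; apply: val_inj.
  by have [] := eq_st i (mem_enum _ i).
have uniq_l : uniq [seq one_line s | s <- enum 'S_n] by rewrite map_inj_uniq ?enum_uniq.
apply: uniq_perm => //; first exact: perm_words_uniq.
apply: (uniq_min_size _ _ _).2 => //.
- move=> _ /mapP[s _ ->]; rewrite perm_words_perm; apply: uniq_perm; last 1 first.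
  + move=> x; rewrite mem_iota add1n; apply/mapP/idP => [[i _ ->]|/andP[x_gt0 lt_xn]].
      by rewrite /= ltnS ltn_ord.
    case: x x_gt0 lt_xn => // x _; rewrite ltnS => lt_xn.
    by exists (s^-1%g (Ordinal lt_xn)); rewrite ?mem_enum ?permKV.
  + by rewrite map_inj_uniq ?enum_uniq // => i j [/val_inj/perm_inj].
  exact: iota_uniq.
by rewrite size_map size_perm_words -cardE card_Sn.
Qed.

Lemma descentsE u : descents u = des u.
Proof.
rewrite /descents -sum1_card big_mkcond /=.
elim: u => [|x u IHu]; first by rewrite big_ord0.
rewrite [des _]/= -IHu big_ord_recl inE /=; congr (_ + _)%N.
  by case: u {IHu} => //= y u; case: ltnP.
by apply: eq_bigr => i _; rewrite !inE lift0.
Qed.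

Definition perm_weight (R : comNzRingType) (z : R) n (w : seq nat) : R :=
  z ^+ des w * perm_tree 1 z n (first_run w).

Section PermCount.
Variables (R : comNzRingType) (z : R).

Lemma big_perm_words_S (P : pred (seq nat)) (F : seq nat -> R) m :
  \sum_(u <- perm_words m.+1 | P u) F u =
    \sum_(w <- perm_words m)
      \sum_(0 <= j < m.+1 | P (insert_at j m.+1 w)) F (insert_at j m.+1 w).
Proof.
rewrite big_mkcond (@big_allpairs_dep _ _ _ _ (fun=> nat) _ (fun w j => insert_at j m.+1 w)
  (perm_words m) (fun=> iota 0 m.+1)) /=.
by apply: eq_bigr => w _; rewrite [RHS]big_mkcond.
Qed.

Lemma perm_weight_children n m w : w \in perm_words m -> ~~ contains213 w ->
  \sum_(0 <= j < m.+1 | ~~ contains213 (insert_at j m.+1 w))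
     perm_weight z n (insert_at j m.+1 w) = perm_weight z n.+1 w.
Proof.
move=> wm nc_w; have sz_w := perm_words_size wm; have w_lt := perm_words_lt wm.
have run_le : (first_run w <= m)%N by rewrite -sz_w first_run_size.
rewrite big_nat_cond (eq_bigl (fun j => (0 <= j < m.+1)%N && (j < (first_run w).+1)%N)).
  rewrite -big_nat_cond -(big_nat_widen 0 (first_run w).+1 m.+1 xpredT) //.
  (* The last index, at the end of the initial run, is the harmless insertion that adds no
     descent. *)
  rewrite big_nat_recr //= big_mkord.
  have -> : \sum_(j < first_run w) perm_weight z n (insert_at j m.+1 w) =
      z ^+ des w * (z * \sum_(j < first_run w) perm_tree 1 z n j.+1).
    rewrite mulrA mulr_sumr; apply: eq_bigr => j _.
    by rewrite /perm_weight des_insert ?first_run_insert ?(ltnW (ltn_ord j)) // ltn_ord addn1 exprSr.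
  rewrite {1}/perm_weight des_insert // first_run_insert // ltnn addn0.
  by rewrite -mulrDr /perm_weight /perm_tree -/perm_tree mul1r addrC.
move=> j; case: (ltnP j m.+1) => //= lt_jm.
by rewrite contains213_insert ?sz_w // (negPf nc_w) /= negbK sorted_take_run ?sz_w // ltnS.
Qed.

Lemma contains213_insert_perm m w j : w \in perm_words m -> (j < m.+1)%N ->
  contains213 w -> contains213 (insert_at j m.+1 w).
Proof.
move=> wm lt_jm c_w.
by rewrite contains213_insert ?c_w ?(perm_words_lt wm) // (perm_words_size wm) -ltnS.
Qed.

Lemma perm_weight_level n m :
  \sum_(w <- perm_words m.+1 | ~~ contains213 w) perm_weight z n w =
    \sum_(w <- perm_words m | ~~ contains213 w) perm_weight z n.+1 w.
Proof.
rewrite (big_perm_words_S (fun w => ~~ contains213 w)) [RHS]big_mkcond.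
apply: eq_big_seq => w wm /=; case: ifPn => [nc_w|]; first exact: perm_weight_children.
rewrite negbK => c_w; rewrite big_nat_cond big_pred0 // => j.
by case: ltnP => //= lt_jm; rewrite (contains213_insert_perm wm lt_jm c_w).
Qed.

Lemma sum_avoiding_perms n :
  \sum_(w <- perm_words n | ~~ contains213 w) z ^+ des w = perm_tree 1 z n 0.
Proof.
have weight0 w : perm_weight z 0 w = z ^+ des w by rewrite /perm_weight mulr1.
rewrite -(eq_bigr _ (fun w _ => weight0 w)).
have step d : (d <= n)%N -> \sum_(w <- perm_words n | ~~ contains213 w) perm_weight z 0 w =
    \sum_(w <- perm_words (n - d) | ~~ contains213 w) perm_weight z d w.
  elim: d => [|d IHd] lt_dn; first by rewrite subn0.
  by rewrite (IHd (ltnW lt_dn)) -subnSK // perm_weight_level.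
rewrite (step n) // subnn big_cons big_nil ifT; first by rewrite /perm_weight /= addr0 mul1r.
by apply/contains213P => -[a [b [c []]]]; rewrite /= ltn0 andbF.
Qed.

Lemma sum_over_avoiding_perms m :
  \sum_(u <- perm_words m.+1 | ~~ contains213 (rem m.+1 u)) z ^+ des u =
    \sum_(w <- perm_words m | ~~ contains213 w)
      z ^+ des w * (z * (m%:R - (des w)%:R) + (des w)%:R + 1).
Proof.
rewrite (big_perm_words_S (fun u => ~~ contains213 (rem m.+1 u))) [RHS]big_mkcond.
apply: eq_big_seq => w wm /=.
rewrite (eq_bigl (fun=> ~~ contains213 w)) => [|j]; last by rewrite rem_insert_at ?perm_words_notin.
case: ifP => _; last by rewrite big_pred0_eq.
by rewrite -[in LHS](perm_words_size wm) sum_des_insert ?(perm_words_size wm) // perm_words_lt.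
Qed.

End PermCount.

Lemma des_size x s : (des (x :: s) <= size s)%N.
Proof. by elim: s x => //= y s IHs x; have := IHs y; case: (y < x)%N => /=; lia. Qed.

Lemma des_eq0_sorted u : des u = 0%N -> sorted leq u.
Proof.
case: u => // x u; elim: u x => //= y u IHu x /eqP; rewrite addn_eq0 => /andP[].
by case: ltnP => //= _ _ /eqP; apply: IHu.
Qed.

Lemma des_max_sorted x s : (size s <= des (x :: s))%N -> sorted gtn (x :: s).
Proof.
elim: s x => //= y s IHs x; have := des_size y s; have := IHs y => /=.
case: (y < x)%N => /=; last lia.
by rewrite add1n ltnS.
Qed.

(** A word without descents is weakly increasing and one with only descents is decreasing; neither
    contains 213. *)
Lemma des_contains213 u : contains213 u -> (0 < des u < (size u).-1)%N.
Proof.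
case/contains213P => a [b [c [lt_ab /andP[lt_bc lt_cu] ba ac]]].
have lt_bu := ltn_trans lt_bc lt_cu; have lt_au := ltn_trans lt_ab lt_bu.
apply/andP; split.
  rewrite lt0n; apply: contraTneq ba => /des_eq0_sorted srt.
  by rewrite -leqNgt; apply: (sorted_leq_nth leq_trans leqnn 0%N srt) => //; apply: ltnW.
case: u lt_cu lt_bu lt_au ba ac => // x s lt_cu lt_bu lt_au ba ac.
rewrite ltnNge; apply: contraTN ac => /des_max_sorted srt.
have gtn_trans : transitive gtn by move=> i j k /= ji ik; apply: ltn_trans ik ji.
rewrite -leqNgt ltnW //.
by apply: (sorted_ltn_nth gtn_trans 0%N srt) => //; apply: ltn_trans lt_bc.
Qed.

(* The range of d loses nothing, by des_contains213. *)
Lemma sum_G213 (R : comNzRingType) (z : R) j : (0 < j)%N ->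
  \sum_(1 <= d < j.-1) z ^+ d * #|G213 j d|%:R =
    \sum_(u <- perm_words j | ~~ contains213 (rem j u)) z ^+ des u
    - \sum_(u <- perm_words j | ~~ contains213 u) z ^+ des u.
Proof.
move=> j_gt0; pose Q u := contains213 u && ~~ contains213 (rem j u).
have -> : \sum_(1 <= d < j.-1) z ^+ d * #|G213 j d|%:R = \sum_(u <- perm_words j | Q u) z ^+ des u.
  have cardE d : #|G213 j d|%:R = \sum_(u <- perm_words j | Q u) (des u == d)%:R :> R.
    rewrite -(perm_big _ (perm_one_line j)) big_map big_enum_cond /= -sum1_card natr_sum.
    rewrite big_mkcond [RHS]big_mkcond; apply: eq_bigr => s _.
    by rewrite inE /Q descentsE; case: contains213 => //=; case: (_ == d); case: contains213.
  rewrite (eq_bigr _ (fun d _ => congr1 _ (cardE d))).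
  under eq_bigr do rewrite mulr_sumr.
  rewrite exchange_big /= big_seq_cond [RHS]big_seq_cond.
  apply: eq_bigr => u /andP[uj /andP[c_u _]].
  have := des_contains213 c_u; rewrite (perm_words_size uj) => lt_des.
  have := big_nat1_eq +%R (fun d => z ^+ d) (des u) 1 j.-1; rewrite lt_des => <-.
  rewrite [RHS]big_mkcond; apply: eq_bigr => d _.
  by rewrite eq_sym; case: eqP => _; rewrite ?mulr1 ?mulr0.
apply/eqP; rewrite eq_sym subr_eq; apply/eqP.
rewrite big_mkcond [X in _ = X + _]big_mkcond [X in _ = _ + X]big_mkcond -big_split /=.
apply: eq_big_seq => u uj; rewrite /Q.
case: j j_gt0 uj {Q} => // m _ /allpairsPdep[w [j [wm jm ->]]].
rewrite rem_insert_at ?perm_words_notin //; rewrite mem_iota in jm.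
have := @contains213_insert_perm _ w j wm jm.
case: (contains213 w) => [/(_ isT)->|_] /=; first by rewrite addr0.
by case: contains213 => /=; rewrite ?addr0 ?add0r.
Qed.

(** * Comparison of the two trees *)

Lemma ballot_polyC n m d : ballot {poly rat} n m d = (ballot rat n m d)%:P.
Proof.
by rewrite /ballot rmorphB rmorphM !rmorph_nat; case: d => [|d];
  rewrite ?rmorphM ?rmorph_nat ?rmorph0.
Qed.

Lemma perm_treeS0 (R : comNzRingType) (a b : R) n :
  perm_tree a b n.+1 0 = a * \sum_(d < n.+1) ballot R n n d * a ^+ (n - d) * b ^+ d.
Proof. by rewrite {1}/perm_tree -/perm_tree big_ord0 mulr0 addr0 perm_tree_ballot addn0. Qed.

(** Comparing coefficients in [sum_avoiding_perms] at [z = 'X] shows that [ballot rat n n d] of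
    these permutations have [d] descents. *)
Lemma sum_avoiding_perms_des n (g : nat -> rat) :
  \sum_(w <- perm_words n.+1 | ~~ contains213 w) g (des w) =
    \sum_(d < n.+1) ballot rat n n d * g d.
Proof.
have des_lt w : w \in perm_words n.+1 -> (des w < n.+1)%N.
  by move=> /perm_words_size; case: w => // x s [<-]; rewrite ltnS des_size.
have := sum_avoiding_perms ('X : {poly rat}) n.+1; rewrite perm_treeS0 mul1r => polyE.
have coefE (d : 'I_n.+1) :
    \sum_(w <- perm_words n.+1 | ~~ contains213 w) (des w == d)%:R = ballot rat n n d.
  have := congr1 (fun p : {poly rat} => p`_d) polyE; rewrite !coef_sum.
  under eq_bigr do rewrite coefXn eq_sym.
  move=> ->; rewrite (bigD1 d) //= big1 ?addr0 => [|d' ne_d'].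
    by rewrite ballot_polyC expr1n mulr1 coefCM coefXn eqxx mulr1.
  by rewrite ballot_polyC expr1n mulr1 coefCM coefXn val_eqE eq_sym (negPf ne_d') mulr0.
under [RHS]eq_bigr do rewrite -coefE mulr_suml.
rewrite exchange_big /= big_seq_cond [RHS]big_seq_cond; apply: eq_bigr => w /andP[/des_lt lt_wn _].
rewrite (bigD1 (Ordinal lt_wn)) //= eqxx mul1r big1 ?addr0 // => d.
by rewrite -val_eqE /= eq_sym => /negPf->; rewrite mul0r.
Qed.

Lemma avoiding_chains_ballot n :
  (avoiding_chains n.+1)%:R = \sum_(d < n.+1) ballot rat n n d * 2 ^+ d.
Proof.
have := sum_avoiding_chains (1 : rat) n.+1; rewrite decr_tree_perm perm_treeS0 mul1r.
rewrite /avoiding_chains -sum1_count natr_sum => E.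
under eq_bigr do rewrite -(expr1n _ 0).
transitivity (\sum_(p <- rank_words n.+1 | ~~ has_stop p.2) 1 ^+ p.1 : rat).
  by apply: eq_bigr => p _; rewrite !expr1n.
by rewrite E; apply: eq_bigr => d _; rewrite expr1n mulr1.
Qed.

(** Twice the derivative at [y = 1] of the block polynomial, whose terms are multiples of
    [y ^ (n + 1 - d) * (1 + y) ^ d]. *)
Lemma sum_chain_blocks n :
  \sum_(p <- rank_words n.+1 | ~~ has_stop p.2) (p.1.*2)%:R =
    \sum_(d < n.+1) ballot rat n n d * (2 ^+ d * (2 * (n.+1%:R - d%:R) + d%:R)).
Proof.
have := sum_avoiding_chains ('X : {poly rat}) n.+1; rewrite decr_tree_perm perm_treeS0.
move=> /(congr1 (fun p : {poly rat} => 2 * (p^`()).[1])).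
rewrite raddf_sum horner_sum mulr_sumr mulr_sumr raddf_sum horner_sum mulr_sumr => E.
transitivity (\sum_(p <- rank_words n.+1 | ~~ has_stop p.2) 2 * ('X^(p.1))^`().[1] : rat).
  by apply: eq_bigr => p _; rewrite derivXn hornerMn hornerXn expr1n -muln2 natrM mulrC.
rewrite E; apply: eq_bigr => d _; have le_dn : (d <= n)%N by rewrite -ltnS.
rewrite ballot_polyC; set c := ballot rat n n d.
have -> : 'X * (c%:P * 'X^(n - d) * (1 + 'X) ^+ d) = c *: ('X^((n - d).+1) * (1 + 'X) ^+ d).
  by rewrite -mul_polyC exprS; ring.
rewrite /= derivZ hornerZ mulrCA; congr (_ * _).
rewrite derivM derivXn deriv_exp derivD derivX derivC /=.
rewrite !(hornerE, hornerMn, horner_exp) !expr1n.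
rewrite -subSn // natrB ?leqW //.
by case: (d : nat) => [|k]; rewrite -mulr_natr /= ?exprS; ring.
Qed.

(** At [z = 2] the insertions into a permutation of length [m] with [d] descents contribute the
    factor [2(m-d)+d+1], which matches the summed [2k+1] of the chains. *)
Lemma chains_over_avoiding_perms m :
  (chains_over_avoiding m.+1)%:R =
    \sum_(u <- perm_words m.+1 | ~~ contains213 (rem m.+1 u)) 2 ^+ des u :> rat.
Proof.
rewrite count_chain_children sum_over_avoiding_perms; case: m => [|m].
  rewrite !big_cons !big_nil ifT; last first.
    by apply/contains213P => -[a [b [c []]]]; rewrite /= ltn0 andbF.
  by rewrite /= !addr0; ring.
rewrite (sum_avoiding_perms_des m (fun d => 2 ^+ d * (2 * (m.+1%:R - d%:R) + d%:R + 1))).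
have -> : \sum_(p <- rank_words m.+1 | ~~ has_stop p.2) (p.1.*2.+1)%:R =
    \sum_(p <- rank_words m.+1 | ~~ has_stop p.2) (p.1.*2)%:R + (avoiding_chains m.+1)%:R :> rat.
  rewrite /avoiding_chains -sum1_count natr_sum -big_split.
  by apply: eq_bigr => p _; rewrite mulrSr.
rewrite sum_chain_blocks avoiding_chains_ballot -big_split; apply: eq_bigr => d _ /=; ring.
Qed.

Lemma woc_count_narayana n : (0 < n)%N ->
  (woc_count n)%:R =
    \sum_(0 <= d < n) 2 ^+ d * narayana n d
    + \sum_(3 <= j < n.+1) \sum_(1 <= d < j.-1) 2 ^+ d * #|G213 j d|%:R :> rat.
Proof.
have avoidE k : (avoiding_chains k.+1)%:R =
    \sum_(w <- perm_words k.+1 | ~~ contains213 w) 2 ^+ des w :> rat.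
  by rewrite (sum_avoiding_perms_des k (fun d => 2 ^+ d)) avoiding_chains_ballot.
move=> n_gt0; rewrite woc_countE //; congr (_ + _).
  case: n n_gt0 => // n _; rewrite avoiding_chains_ballot big_mkord.
  by apply: eq_bigr => d _; rewrite narayana_ballot mulrC.
(* For [j] equal to 1 or 2 the range of [d] is empty, so the outer sum may start at 1. *)
rewrite (big_nat_widenl 3 1) // [RHS]big_mkcond; apply: eq_big_nat => j /andP[j_gt0 _] /=.
transitivity (\sum_(1 <= d < j.-1) 2 ^+ d * #|G213 j d|%:R : rat).
  by rewrite sum_G213 //; case: j j_gt0 => // j _; rewrite chains_over_avoiding_perms avoidE.
by case: ltnP => // le_j2; rewrite big_geq //; case: j j_gt0 le_j2 => // -[|[]].
Qed.

(** * Generating function and first values *)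

(** The equation for [U], coefficient by coefficient: the tree of label 2 is counted by [U ^ 2]. *)
Lemma chain_tree_quadratic (R : comNzRingType) (y : R) n :
  chain_tree y n.+1 1 =
    chain_tree y n 1 + y * \sum_(k < n.+1) chain_tree y k 1 * chain_tree y (n - k) 1.
Proof.
by rewrite chain_treeS -chain_tree_mul {1}/chain_tree big_ord0 add0r.
Qed.

Definition chain_val n : rat := (chain_tree 'X n 1).[1].
Definition chain_deriv n : rat := ((chain_tree ('X : {poly rat}) n 1)^`()).[1].

Lemma chain_val0 : chain_val 0 = 1.
Proof. by rewrite /chain_val /chain_tree hornerC. Qed.

Lemma chain_deriv0 : chain_deriv 0 = 0.
Proof. by rewrite /chain_deriv /chain_tree derivC hornerC. Qed.

Lemma chain_valS n :
  chain_val n.+1 = chain_val n + \sum_(k < n.+1) chain_val k * chain_val (n - k).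
Proof.
rewrite /chain_val chain_tree_quadratic hornerD hornerM hornerX mul1r horner_sum.
by congr (_ + _); apply: eq_bigr => k _; rewrite hornerM.
Qed.

Lemma chain_derivS n :
  chain_deriv n.+1 = chain_deriv n + \sum_(k < n.+1) chain_val k * chain_val (n - k)
    + 2 * \sum_(k < n.+1) chain_val k * chain_deriv (n - k).
Proof.
rewrite /chain_deriv chain_tree_quadratic derivD derivM derivX mul1r hornerD -addrA.
congr (_ + _); rewrite hornerD hornerM hornerX mul1r horner_sum; congr (_ + _).
  by apply: eq_bigr => k _; rewrite hornerM.
rewrite raddf_sum horner_sum mulr_natl mulr2n -[X in _ = X + _](_ : \sum_(k < n.+1)
    chain_deriv k * chain_val (n - k) = _); last first.
  (* Reversing the index identifies the two halves of the product rule. *)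
  rewrite (reindex_inj rev_ord_inj); apply: eq_bigr => k _.
  by rewrite /= subSS subKn 1?mulrC // -ltnS.
by rewrite -big_split; apply: eq_bigr => k _; rewrite /= derivM hornerD !hornerM.
Qed.

Lemma sum_avoiding_chains_val n :
  (1 + 'X) * \sum_(p <- rank_words n.+1 | ~~ has_stop p.2) 'X^(p.1) =
    'X * chain_tree ('X : {poly rat}) n.+1 1.
Proof. by rewrite sum_avoiding_chains decr_tree_chain {1}/chain_tree big_ord0 add0r. Qed.

Lemma avoiding_chains_val n : 2 * (avoiding_chains n.+1)%:R = chain_val n.+1.
Proof.
have := congr1 (fun p : {poly rat} => p.[1]) (sum_avoiding_chains_val n).
rewrite !hornerM hornerD hornerC hornerX mul1r -/(chain_val _) => <-; congr (_ * _).
rewrite horner_sum /avoiding_chains -sum1_count natr_sum.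
by apply: eq_bigr => p _; rewrite hornerXn expr1n.
Qed.

(** With [A] the block polynomial, differentiating [(1 + y) A = y U] at [y = 1] gives
    [A + 2 A' = U + U'], and the left side is the sum of [2k+1]. *)
Lemma chains_over_avoiding_val n :
  (chains_over_avoiding n.+1)%:R = chain_val n + chain_deriv n.
Proof.
rewrite count_chain_children; case: n => [|n].
  by rewrite big_cons big_nil chain_val0 chain_deriv0 /= addr0.
have := congr1 (fun p : {poly rat} => p^`().[1]) (sum_avoiding_chains_val n).
rewrite !derivM derivD derivX derivC add0r !mul1r !(hornerD, hornerM, hornerX, hornerC) !mul1r.
rewrite -/(chain_val _) -/(chain_deriv _) => <-; rewrite !raddf_sum !horner_sum mulr_sumr.
rewrite -big_split; apply: eq_bigr => p _ /=.
rewrite derivXn hornerMn !hornerXn !expr1n -addnn mulrSr natrD; ring.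
Qed.

(** Successive counts differ by the chains over avoiding parents at level [n.+1] minus the avoiding
    chains at level [n], which number half of [chain_val n] when [n] is positive. *)
Lemma woc_countS n :
  (woc_count n.+1)%:R =
    (if n == 0 then 0 else (woc_count n)%:R - chain_val n / 2) + chain_val n + chain_deriv n.
Proof.
rewrite woc_countE // big_nat_recr // chains_over_avoiding_val; case: n => [|n].
  by rewrite big_geq //=; ring.
by rewrite woc_countE //= -!avoiding_chains_val; field.
Qed.

Section FormalSeries.
Variable K : fieldType.
Implicit Types f g : fps K.

Lemma fcoefM f g n : fcoef (f * g) n = \sum_(i < n.+1) fcoef f i * fcoef g (n - i).
Proof. by []. Qed.

Lemma fcoefD f g n : fcoef (f + g) n = fcoef f n + fcoef g n.
Proof. by []. Qed.

Lemma fcoefN f n : fcoef (- f) n = - fcoef f n.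
Proof. by []. Qed.

Lemma fcoef1 n : fcoef (1 : fps K) n = (n == 0)%:R.
Proof. by case: n. Qed.

Lemma fcoefMn f k n : fcoef (f *+ k) n = fcoef f n *+ k.
Proof.
by elim: k => [|k IHk]; [case: n | rewrite !mulrS fcoefD IHk].
Qed.

Lemma fcoefXM f n : fcoef (fpsX * f) n = if n is n'.+1 then fcoef f n' else 0.
Proof.
rewrite fcoefM; case: n => [|n]; first by rewrite big_ord1 mul0r.
rewrite 2!big_ord_recl big1 ?addr0 => [|i _]; last by rewrite mul0r.
by rewrite mul0r add0r mul1r subSS subn0.
Qed.

(** In the difference of squares, the sum of the two roots has constant term 2 and is invertible. *)
Lemma fps_sqrt_uniq f g : (2 : K) != 0 -> fcoef f 0 = 1 -> fcoef g 0 = 1 ->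
  g ^+ 2 = f -> fps_sqrt f = g.
Proof.
move=> nz2 f0 g0 g2; apply/eqP; rewrite -subr_eq0; apply/eqP.
have unit_sum : fps_sqrt f + g \is a GRing.unit.
  by rewrite unfold_in /= /fps_unit fcoefD fcoef_sqrt0 g0.
by apply: (mulIr unit_sum); rewrite mul0r -subr_sqr fps_sqrtK // g2 subrr.
Qed.

End FormalSeries.

(** Completing the square in the quadratic equation of [U] at [y = 1], whose discriminant is
    [1 - 6x + x^2]. *)
Lemma sqrt_identity (R : comNzRingType) (x u : R) :
  (1 - x - 2 * (x * u)) ^+ 2 - (1 - 6 * x + x ^+ 2) = 4 * x * (1 + x * u + x * (u * u) - u).
Proof. ring. Qed.

Lemma gf_identity (R : comNzRingType) (x u v w : R) :
  u = 1 + x * u + x * (u * u) -> v = x * v + x * (u * u) + 2 * (x * (u * v)) ->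
  2 * w = 2 * (x * w) + 2 * (x * u + x * v) - x * (u - 1) ->
  w * (4 * (1 - x) * (1 - x - 2 * (x * u))) =
    (1 - x) ^+ 2 - (1 - 3 * x) * (1 - x - 2 * (x * u)).
Proof.
move=> uE vE wE; set s := 1 - x - 2 * (x * u).
(* The equation of [v] is linear, with coefficient [s]. *)
have vs : v * s = x * (u * u).
  rewrite (_ : v * s = v - (x * v + 2 * (x * (u * v)))); last by rewrite /s; ring.
  by rewrite {1}vE; ring.
transitivity (2 * s * (2 * w - 2 * (x * w))); first by ring.
rewrite wE (_ : 2 * s * _ = 4 * s * x * u + 4 * x * (v * s) - 2 * s * x * (u - 1)); last by ring.
by rewrite vs /s; ring.
Qed.

Lemma woc_count_gf :
  (Fps (fun n => if n == 0%N then 0 else (woc_count n)%:R) : fps rat) =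
        ((1 - fpsX) ^+ 2 - (1 - 3 * fpsX) * fps_sqrt (1 - 6 * fpsX + fpsX ^+ 2))
        / (4 * (1 - fpsX) * fps_sqrt (1 - 6 * fpsX + fpsX ^+ 2)).
Proof.
pose x : fps rat := fpsX; rewrite -/x.
pose U := Fps chain_val; pose V := Fps chain_deriv.
have coefXM f n : fcoef (x * f) n = if n is n'.+1 then fcoef f n' else 0 by exact: fcoefXM.
have UE : U = 1 + x * U + x * (U * U).
  apply/fpsP => -[|n]; rewrite !fcoefD !coefXM fcoef1 ?fcoefM.
    by rewrite !addr0 [LHS]chain_val0.
  by rewrite add0r [LHS]chain_valS.
have VE : V = x * V + x * (U * U) + 2 * (x * (U * V)).
  apply/fpsP => -[|n]; rewrite !fcoefD mulr_natl fcoefMn !coefXM ?fcoefM.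
    by rewrite mul0rn !addr0 [LHS]chain_deriv0.
  by rewrite -mulr_natl [LHS]chain_derivS.
set W := Fps _.
(* This is [woc_countS] doubled; [U - 1] in place of [U] accounts for its exceptional case
   [n = 0]. *)
have WE : 2 * W = 2 * (x * W) + 2 * (x * U + x * V) - x * (U - 1).
  have coefXM0 f : fcoef (x * f) 0 = 0 by rewrite coefXM.
  have coefXMS f n : fcoef (x * f) n.+1 = fcoef f n by rewrite coefXM.
  have WS n : fcoef W n.+1 = (woc_count n.+1)%:R by [].
  apply/fpsP => -[|n]; rewrite !mulr_natl !(fcoefD, fcoefN, fcoefMn, coefXM0, coefXMS, fcoef1).
    by rewrite [fcoef W 0]/=; ring.
  rewrite WS woc_countS -[fcoef U n]/(chain_val n) -[fcoef V n]/(chain_deriv n).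
  by case: n => [|n]; rewrite ?WS ?[fcoef W 0]/= ?chain_val0 /=; field.
have coef0 : fcoef (1 - 6 * x + x ^+ 2) 0 = 1.
  by rewrite !fcoefD fcoefN mulr_natl fcoefMn expr2 coefXM /= mul0rn subr0 addr0.
have sqrtE : fps_sqrt (1 - 6 * x + x ^+ 2) = 1 - x - 2 * (x * U).
  apply: fps_sqrt_uniq => //.
    by rewrite !fcoefD !fcoefN mulr_natl fcoefMn coefXM /= mul0rn !subr0.
  apply/eqP; rewrite -subr_eq0 (_ : _ - _ = 4 * x * (1 + x * U + x * (U * U) - U)); last exact: sqrt_identity.
  by rewrite -UE subrr mulr0.
have unitD : 4 * (1 - x) * fps_sqrt (1 - 6 * x + x ^+ 2) \is a GRing.unit.
  rewrite unfold_in /= /fps_unit fcoefM big_ord1 fcoef_sqrt0 mulr1 mulr_natl fcoefMn.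
  by rewrite fcoefD fcoefN fcoef1 subr0.
apply: (canRL (mulrK unitD)); rewrite sqrtE.
exact: gf_identity UE VE WE.
Qed.

Lemma double_woc_count n :
  2 * (woc_count n.+1)%:R =
    2 + \sum_(1 <= k < n.+1) (chain_val k + 2 * chain_deriv k) :> rat.
Proof.
elim: n => [|n IHn].
  by rewrite woc_countS /= chain_val0 chain_deriv0 big_geq //; ring.
by rewrite woc_countS big_nat_recr //= addrA -IHn; field.
Qed.

(* Binary numbers keep the values out of unary arithmetic. *)
Definition conv_bin (s t : seq N) (n : nat) : N :=
  foldr (fun k a => N.add (N.mul (nth N0 s k) (nth N0 t (n - k))) a) N0 (iota 0 n.+1).

Arguments conv_bin : simpl never.

(** One step of [chain_valS] on [s] and of [chain_derivS] on [t]; [n] is the last index already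
    tabulated. *)
Definition chain_table_step (st : seq N * seq N) : seq N * seq N :=
  let: (s, t) := st in let n := (size s).-1 in
  (rcons s (N.add (last N0 s) (conv_bin s s n)),
   rcons t (N.add (N.add (last N0 t) (conv_bin s s n)) (N.add (conv_bin s t n) (conv_bin s t n)))).

Definition chain_table (n : nat) : seq N * seq N :=
  iter n chain_table_step ([:: 1%num], [:: 0%num]).

Lemma natr_add_bin (R : pzRingType) (a b : N) :
  (nat_of_bin (N.add a b))%:R = (nat_of_bin a)%:R + (nat_of_bin b)%:R :> R.
Proof. by case: a b => [|p] [|q]; rewrite ?add0r ?addr0 // -natrD -nat_of_add_pos. Qed.

Lemma natr_mul_bin (R : pzRingType) (a b : N) :
  (nat_of_bin (N.mul a b))%:R = (nat_of_bin a)%:R * (nat_of_bin b)%:R :> R.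
Proof. by case: a b => [|p] [|q]; rewrite ?mul0r ?mulr0 // -natrM -nat_of_mul_pos. Qed.

Lemma natr_conv_bin (f g : nat -> rat) s t n :
  (forall k, (k <= n)%N -> (nat_of_bin (nth N0 s k))%:R = f k) ->
  (forall k, (k <= n)%N -> (nat_of_bin (nth N0 t k))%:R = g k) ->
  (nat_of_bin (conv_bin s t n))%:R = \sum_(k < n.+1) f k * g (n - k)%N.
Proof.
move=> fE gE; rewrite -(big_mkord xpredT (fun k => f k * g (n - k)%N)) /index_iota subn0.
rewrite /conv_bin; have: all (fun k => k <= n)%N (iota 0 n.+1).
  by apply/allP => k; rewrite mem_iota.
elim: (iota 0 n.+1) => [|k r IHr] /=; first by rewrite big_nil.
by case/andP=> le_kn /IHr {}IHr; rewrite big_cons natr_add_bin natr_mul_bin IHr fE ?gE ?leq_subr.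
Qed.

Lemma chain_tableP n :
  [/\ size (chain_table n).1 = n.+1, size (chain_table n).2 = n.+1,
      forall k, (k <= n)%N -> (nat_of_bin (nth N0 (chain_table n).1 k))%:R = chain_val k
    & forall k, (k <= n)%N -> (nat_of_bin (nth N0 (chain_table n).2 k))%:R = chain_deriv k].
Proof.
elim: n => [|n]; first by split=> // -[|//] _; rewrite ?chain_val0 ?chain_deriv0.
rewrite /chain_table iterS -/(chain_table n); case: (chain_table n) => s t /= [sz_s sz_t sE tE].
rewrite sz_s /= -!nth_last sz_s sz_t /=; split=> [||k|k]; rewrite ?size_rcons ?sz_s ?sz_t //;
  rewrite leq_eqVlt => /predU1P[->|lt_kn]; rewrite nth_rcons ?sz_s ?sz_t ?lt_kn ?ltnn ?eqxx.
- rewrite natr_add_bin (natr_conv_bin sE sE) sE // chain_valS //.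
- exact: sE.
- rewrite (natr_add_bin _ (N.add _ _)) (natr_add_bin _ (nth _ _ _)).
  rewrite (natr_add_bin _ (conv_bin s t n)).
  rewrite (natr_conv_bin sE sE) (natr_conv_bin sE tE) tE //.
  by rewrite chain_derivS mulr_natl mulr2n.
- exact: tE.
Qed.

Definition double_woc_bin (n : nat) : N :=
  let: (s, t) := chain_table n in
  foldr (fun k a => N.add (N.add (nth N0 s k) (N.add (nth N0 t k) (nth N0 t k))) a) 2%num (iota 1 n).

(** Comparing doubled values avoids the halves in [woc_countS], so the hypothesis is a closed
    computation in [N]. *)
Lemma woc_count_bin n k : double_woc_bin n = N.mul 2 k -> woc_count n.+1 = nat_of_bin k.
Proof.
move=> kE; apply/eqP; rewrite -(Num.Theory.eqr_nat rat); apply/eqP.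
apply: (@mulfI rat 2) => //; rewrite double_woc_count -[2 in RHS]/((nat_of_bin 2)%:R).
rewrite -natr_mul_bin -kE /double_woc_bin; have [_ _] := chain_tableP n.
case: (chain_table n) => s t /= sE tE.
rewrite /index_iota subSS subn0; have: all (fun k => k <= n)%N (iota 1 n).
  by apply/allP => j; rewrite mem_iota add1n ltnS => /andP[].
elim: (iota 1 n) => [|j r IHr] /=; first by rewrite big_nil addr0.
case/andP=> le_jn /IHr {}IHr; rewrite big_cons !natr_add_bin sE ?tE // -IHr.
by rewrite /=; ring.
Qed.

Theorem theorem10 :
  [/\ forall n : nat, (0 < n)%N ->
        (woc_count n)%:R =
          \sum_(0 <= d < n) 2 ^+ d * narayana n d
          + \sum_(3 <= j < n.+1) \sum_(1 <= d < j.-1) 2 ^+ d * #|G213 j d|%:R :> rat,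
      [seq woc_count n | n <- iota 1 10] =
        [seq nat_of_bin k
           | k <- [:: 1%num; 3%num; 13%num; 65%num; 341%num; 1827%num; 9913%num;
                      54273%num; 299209%num; 1658723%num]]
    & (Fps (fun n => if n == 0%N then 0 else (woc_count n)%:R) : fps rat) =
        ((1 - fpsX) ^+ 2 - (1 - 3 * fpsX) * fps_sqrt (1 - 6 * fpsX + fpsX ^+ 2))
        / (4 * (1 - fpsX) * fps_sqrt (1 - 6 * fpsX + fpsX ^+ 2))].
Proof.
split; first exact: woc_count_narayana; last exact: woc_count_gf.
cbn [iota map].
by do 10 (apply: (congr2 cons); first by apply: woc_count_bin; vm_compute).
Qed.
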